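(* Consider the witness encryption scheme described in the context. Fix an unsatisfiable $\varphi$ and any accepted prime $p$. Against a classical generic adversary making $Q$ oracle queries, the distinguishing advantage of the scheme (between encryptions of $0$ and of $1$), conditional on the prime $p$ and on successful sampling, is at most $$O\left((Q+m+k)^2\bigl(m^{-d}+p^{-1}\bigr)\right).$$ This holds with arbitrary local computation by the adversary and arbitrary-string oracle inputs. Averaging over the prime and including the common abort outcome, the distinguishing advantage satisfies the same bound with $p^{-1}$ replaced by $2^{-m}$.
   Context: Logarithms have base two; $\mathbb F_p=\mathbb Z/p\mathbb Z$; the $O(\cdot)$ constant is absolute. Generic-group model: for each encryption with prime $p$, the model supplies a fresh uniformly random injection $\sigma:\mathbb F_p\to\{0,1\}^\ell$, $\ell=2\lceil\log p\rceil$; write $g^a=\sigma(a)$, $g=\sigma(1)$. The group oracle (the group context $\Gamma$) takes two strings and an addition/subtraction instruction and returns $\sigma(a+b)$ or $\sigma(a-b)$ if the strings are the valid encodings $\sigma(a),\sigma(b)$, and $\bot$ if either is invalid. The adversary receives $(1^\lambda,\varphi,C)$ and oracle access through $\Gamma$; it may be adaptive, computationally unbounded, and inspect the strings; every oracle call, including on guessed strings, counts as a query. Its advice may depend on the statement but is independent of $\sigma$ and of the encryption coins. The distinguishing advantage is $|\Pr[A=1\mid\beta=0]-\Pr[A=1\mid\beta=1]|$. Matrix reduction used by the scheme: a fixed deterministic algorithm which, given a Boolean circuit satisfiability instance $\varphi$, an integer $N\ge\max\{2,|\varphi|\}$ at least the number of variables in the Boolean quadratic encoding of $\varphi$, and a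 prime $p>\max\{2^N,2NR\}$ with $R=\lfloor\log N\rfloor$, runs in time $\mathrm{poly}(N,\log p)$ and outputs an ordered (linearly independent) basis $M_1,\dots,M_k$ of a space $\mathcal S\subseteq\mathbb F_p^{m\times m}$, $m=(N+1)(2NR+1)\binom{2R}{R}$, such that (i) every satisfying witness of $\varphi$ yields in polynomial time $a\in\mathbb F_p^k$, $u,v\in\mathbb F_p^m$ with $\sum_j a_jM_j=uv^T\neq0$, $v\in\{0,1\}^m$ with at most $N+1$ nonzero coordinates; (ii) if $\varphi$ is unsatisfiable, every nonzero matrix in $\mathcal S$ has rank at least $R+1$. (The Boolean quadratic encoding has one Boolean variable per circuit input and gate, with equations $b_k-b_ib_j=0$ for AND gates, $b_k+b_i-1=0$ for NOT gates and $b_{\rm out}-1=0$.) Scheme: given $(1^\lambda,\varphi)$, let $n=\max\{2,\lambda,|\varphi|\}$, let $N$ be the larger of $n$ and the number of variables of the encoding of $\varphi$, let $R=\lfloor\log N\rfloor$, $m=(N+1)(2NR+1)\binom{2R}{R}$ and $d=1+\lfloor\log N\rfloor$. Choose a prime $p\in[2^m,2^{m+1})$ and compute $M_1,\dots,M_k$ (so $k\le m^2$). To encrypt $\beta\in\{0,1\}$, obtain a fresh group context $\Gamma$ of order $p$, sample independently and uniformly $s\leftarrow\mathbb F_p^m$, $r\leftarrow\{0,\dots,m-1\}^m$, $\eta\leftarrow\mathbb F_p^k$ (for either message), and output $$C=(p,\Gamma,g,X_1,\dots,X_m,Y_1,\dots,Y_k),\quad X_i=g^{s_i},\quad Y_j=\begin{cases}g^{s^TM_jr},&\beta=0,\\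 g^{\eta_j},&\beta=1.\end{cases}$$ Bounded sampling: the prime is found by testing $m^2$ independent uniform integers in $[2^m,2^{m+1})$ with a deterministic polynomial-time primality test; each coordinate of $s,r,\eta$ is sampled by rejection sampling of binary integers of minimum sufficient bit length with at most $m$ attempts; all coordinates use independent randomness and the schedule is the same for both messages. On any failure a fixed abort symbol is output. The accepted prime is the prime found; conditioned on it and on successful sampling, $s,r,\eta$ are exactly uniform and independent. *)

(* Defs.v *)
From HB Require Import structures.
From mathcomp Require Import all_boot all_order all_algebra.
From mathcomp Require Import classical_sets reals ereal measure.

Set Implicit Arguments.
Unset Strict Implicit.
Unset Printing Implicit Defensive.

Import Order.TTheory GRing.Theory Num.Theory.

Local Open Scope ring_scope.

(** * Boolean circuits *)

(* Wires are numbered: first the circuit inputs, then the gates in order. *)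
Inductive gate := AndGate of nat & nat | NotGate of nat.

Definition gate_below (w : nat) (g : gate) : bool :=
  match g with
  | AndGate i j => (i < w)%N && (j < w)%N
  | NotGate i => (i < w)%N
  end.

Fixpoint gates_wf (w : nat) (gs : seq gate) : bool :=
  if gs is g :: gs' then gate_below w g && gates_wf w.+1 gs' else true.

Record circuit := Circuit {
  inputs : nat;
  gates : seq gate;
  out_wire : nat;
  circuit_wf : gates_wf inputs gates && (out_wire < inputs + size gates)%N
}.

Definition eval_gate (w : seq bool) (g : gate) : bool :=
  match g with
  | AndGate i j => nth false w i && nth false w j
  | NotGate i => ~~ nth false w i
  end.

Definition wire_values (phi : circuit) (x : (inputs phi).-tuple bool) :
    seq bool :=
  foldl (fun w g => rcons w (eval_gate w g)) x (gates phi).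

Definition satisfies (phi : circuit) (x : (inputs phi).-tuple bool) : bool :=
  nth false (wire_values x) (out_wire phi).

Definition satisfiable (phi : circuit) : Prop :=
  exists x : (inputs phi).-tuple bool, satisfies x.

(* The Boolean quadratic encoding has one variable per input and per gate. *)
Definition encoding_vars (phi : circuit) : nat :=
  (inputs phi + size (gates phi))%N.

(** * The matrix reduction *)

Definition log_floor (N : nat) : nat := trunc_log 2 N.

Definition mat_dim (N : nat) : nat :=
  let R := log_floor N in ((N + 1) * (2 * N * R + 1) * 'C(2 * R, R))%N.

(* For prime p, 'F_p is the field Z/pZ; the values of a reduction at composite
   p are irrelevant. *)
Definition reduction : Type :=
  circuit -> forall N p : nat, seq 'M['F_p]_(mat_dim N).

(* [csize] is the instance size |phi|.  It is kept abstract, since nothing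
   depends on the encoding of circuits that is used to measure it. *)
Record reduction_spec (csize : circuit -> nat) (red : reduction)
    (phi : circuit) (N p : nat) : Prop := ReductionSpec {
  reduction_free : free (red phi N p);
  reduction_sat : forall x : (inputs phi).-tuple bool, satisfies x ->
    exists (a : 'I_(size (red phi N p)) -> 'F_p)
           (u v : 'cV['F_p]_(mat_dim N)),
      [/\ \sum_j a j *: (red phi N p)`_j = u *m v^T,
          u *m v^T != 0,
          forall i, v i 0 = 0 \/ v i 0 = 1
        & (#|[pred i | v i 0%R != 0%R]| <= N + 1)%N];
  reduction_unsat : ~ satisfiable phi ->
    forall M : 'M['F_p]_(mat_dim N),
      M \in <<red phi N p>>%VS -> M != 0 -> (log_floor N + 1 <= \rank M)%N
}.

Definition matrix_reduction (csize : circuit -> nat) (red : reduction) : Prop :=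
  forall (phi : circuit) (N p : nat),
    (maxn 2 (csize phi) <= N)%N -> (encoding_vars phi <= N)%N ->
    prime p -> (maxn (2 ^ N) (2 * N * log_floor N) < p)%N ->
    reduction_spec csize red phi N p.

(** * Generic groups and generic adversaries *)

Definition bitstring : Type := seq bool.

Inductive instruction := AddInstr | SubInstr.

(* [None] is the answer "bottom". *)
Definition oracle : Type :=
  bitstring -> bitstring -> instruction -> option bitstring.

Definition code_length (p : nat) : nat := (2 * up_log 2 p)%N.

Definition encoding (p : nat) : finType :=
  {sigma : {ffun 'F_p -> (code_length p).-tuple bool} | injectiveb sigma}.

Definition encode (p : nat) (sigma : encoding p) (a : 'F_p) : bitstring :=
  val sigma a.

Definition decode (p : nat) (sigma : encoding p) (w : bitstring) :
    option 'F_p :=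
  [pick a : 'F_p | encode sigma a == w].

Definition group_oracle (p : nat) (sigma : encoding p) : oracle :=
  fun w1 w2 op =>
    if decode sigma w1 is Some a then
      if decode sigma w2 is Some b then
        Some (encode sigma
          (match op with AddInstr => a + b | SubInstr => a - b end))
      else None
    else None.

(* Deterministic adaptive oracle computations.  The local computation between
   two queries is an arbitrary function of everything seen so far. *)
Inductive strategy :=
  | Return of bool
  | Query of bitstring & bitstring & instruction &
             (option bitstring -> strategy).

Fixpoint run (t : strategy) (O : oracle) : bool :=
  match t with
  | Return b => b
  | Query w1 w2 op next => run (next (O w1 w2 op)) O
  end.

Fixpoint query_count (t : strategy) (O : oracle) : nat :=
  match t with
  | Return _ => 0
  | Query w1 w2 op next => (query_count (next (O w1 w2 op)) O).+1
  end.

(* The group context, as a component of the ciphertext, is an oracle and not a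
   piece of data: it is passed alongside, see [outcome]. *)
Record ciphertext := Ciphertext {
  ct_prime : nat;
  ct_gen : bitstring;
  ct_X : seq bitstring;
  ct_Y : seq bitstring
}.

Inductive outcome := Abort | Encryption of ciphertext & oracle.

(* An adversary gets its own coins w : W, the security parameter, the instance
   and the ciphertext ([None] being the abort symbol). *)
Definition adversary (W : Type) : Type :=
  W -> nat -> circuit -> option ciphertext -> strategy.

Section Interaction.

Variables (W : Type) (A : adversary W) (lam : nat) (phi : circuit).

(* With the abort symbol no group context is handed out. *)
Definition adv_output (w : W) (o : outcome) : bool :=
  match o with
  | Abort => run (A w lam phi None) (fun _ _ _ => None)
  | Encryption C Gamma => run (A w lam phi (Some C)) Gamma
  end.

Definition adv_queries (w : W) (o : outcome) : nat :=
  match o with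
  | Abort => query_count (A w lam phi None) (fun _ _ _ => None)
  | Encryption C Gamma => query_count (A w lam phi (Some C)) Gamma
  end.

End Interaction.

(** * The encryption scheme *)

(* The parameter N of the scheme; R, m and d are functions of it. *)
Definition param_N (csize : circuit -> nat) (lam : nat) (phi : circuit) : nat :=
  maxn (maxn 2 (maxn lam (csize phi))) (encoding_vars phi).

Definition param_d (N : nat) : nat := (1 + log_floor N)%N.

(* The coins for rejection sampling of [n] elements of {0, ..., bound - 1},
   with at most [tries] attempts each. *)
Definition attempts (tries n bound : nat) : finType :=
  {ffun 'I_n -> {ffun 'I_tries -> 'I_(2 ^ up_log 2 bound)}}.

Definition sampled (tries n bound : nat) (t : attempts tries n bound)
    (i : 'I_n) : option nat :=
  ohead [seq x <- [seq nat_of_ord (t i l) | l : 'I_tries] | (x < bound)%N].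

Definition sampling_ok (tries n bound : nat) (t : attempts tries n bound) :
    bool :=
  [forall i, sampled t i].

(* Only meaningful when [sampling_ok t] holds. *)
Definition sample (tries n bound : nat) (t : attempts tries n bound)
    (i : 'I_n) : nat :=
  odflt 0%N (sampled t i).

Definition prime_coins (m : nat) : finType := {ffun 'I_(m ^ 2) -> 'I_(2 ^ m)}.

Definition found_prime (m : nat) (t : prime_coins m) : option nat :=
  ohead [seq x <- [seq (2 ^ m + t l)%N | l : 'I_(m ^ 2)] | prime x].

(* The coins of encryption after the prime p has been found: the encoding of
   the group, and the attempts for s, r and eta. *)
Definition enc_coins (m k p : nat) : finType :=
  (encoding p * attempts m m p * attempts m m m * attempts m k p)%type.

Section Scheme.

Variables (m p : nat) (Ms : seq 'M['F_p]_m).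

(* The message is a boolean: [false] is 0 and [true] is 1. *)
Definition encrypt (beta : bool) (c : enc_coins m (size Ms) p) : outcome :=
  let: (sigma, ts, tr, te) := c in
  if [&& sampling_ok ts, sampling_ok tr & sampling_ok te] then
    let s : 'cV['F_p]_m := \col_i (sample ts i)%:R in
    let r : 'cV['F_p]_m := \col_i (sample tr i)%:R in
    let eta (j : 'I_(size Ms)) : 'F_p := (sample te j)%:R in
    let y (j : 'I_(size Ms)) : 'F_p :=
      if beta then eta j else (s^T *m Ms`_j *m r) 0 0 in
    Encryption
      (Ciphertext p (encode sigma 1)
         [seq encode sigma (s i 0) | i : 'I_m]
         [seq encode sigma (y j) | j : 'I_(size Ms)])
      (group_oracle sigma)
  else Abort.

End Scheme.

(** * Probabilities *)

Definition mean (K : fieldType) (T : finType) (f : T -> K) : K :=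
  (\sum_x f x) / #|T|%:R.

Section Advantage.

Variables (R : realType) (red : reduction) (csize : circuit -> nat).
Variables (lam : nat) (phi : circuit).

Local Notation N := (param_N csize lam phi).
Local Notation m := (mat_dim N).

(* Expectation of a function of the output of the encryption of beta. *)
Definition expect (beta : bool) (f : outcome -> R) : R :=
  mean (fun t : prime_coins m =>
    if found_prime t is Some p then
      mean (fun c : enc_coins m (size (red phi N p)) p =>
        f (encrypt beta c))
    else f Abort).

(* Expectation over the prime search alone; failure contributes 0.  Used for
   the averaged bound, because the dimension k may depend on the prime. *)
Definition expect_prime (f : nat -> R) : R :=
  mean (fun t : prime_coins m =>
    if found_prime t is Some p then f p else 0).

Definition success_with (p : nat) (o : outcome) : bool :=
  if o is Encryption C _ then ct_prime C == p else false.

Variables (disp : measure_display) (W : measurableType disp).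
Variables (P : probability W R) (A : adversary W).

Definition accept_prob (o : outcome) : R :=
  fine (P [set w | adv_output A lam phi w o]%classic).

Definition prob_one (beta : bool) : R := expect beta accept_prob.

(* Conditional on the accepted prime being p and on successful sampling. *)
Definition prob_one_given (p : nat) (beta : bool) : R :=
  expect beta (fun o => (success_with p o)%:R * accept_prob o) /
  expect beta (fun o => (success_with p o)%:R).

Definition advantage : R := `|prob_one false - prob_one true|.

Definition advantage_given (p : nat) : R :=
  `|prob_one_given p false - prob_one_given p true|.

(* The adversary's output must be a random variable. *)
Definition measurable_adversary : Prop :=
  forall o : outcome, measurable [set w | adv_output A lam phi w o]%classic.

Definition makes_queries (Q : nat) : Prop :=
  forall (w : W) (p : nat) (beta : bool)
         (c : enc_coins m (size (red phi N p)) p),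
    prime p -> (2 ^ m <= p < 2 ^ m.+1)%N ->
    (adv_queries A lam phi w (encrypt beta c) <= Q)%N.

End Advantage.

(* Main.v *)
(* Every group element the adversary ever sees is the encoding of a known linear
   form evaluated at a vector of secret exponents.  As long as distinct forms take
   distinct values and the adversary never guesses an encoding, the strings it sees
   are distributed in the same way for both messages: the probability that a random
   injection is consistent with them does not depend on the values of the forms.
   Guessing an encoding has probability O(1/p), since there are at least p^2
   strings.  A nonzero form vanishes with probability at most m^-d + 1/p, also for
   an encryption of 0: there it is an affine function of s with coefficient vector
   a + M r, where M is a combination of the M_j and so, if nonzero, of rank at least
   d, which makes this vector vanish with probability at most m^-d over r; otherwise
   a hyperplane contains s with probability at most 1/p. *)

From HB Require Import structures.
From mathcomp Require Import all_boot all_order all_algebra.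
From mathcomp Require Import classical_sets reals ereal measure.
From mathcomp Require Import fintype fingroup perm zify ring lra.
Require Import Defs.
Set Implicit Arguments.
Unset Strict Implicit.
Unset Printing Implicit Defensive.
Import Order.TTheory GRing.Theory Num.Theory.
Local Open Scope ring_scope.

(** * Symmetries of a random encoding *)

Section Encodings.

Variable p : nat.
Implicit Types (sigma : encoding p) (a b : 'F_p) (xs ys : seq 'F_p).
Implicit Types (u w : bitstring) (zs us : seq bitstring).

Lemma encode_inj sigma : injective (encode sigma).
Proof.
by move=> a b /val_inj; move: (valP sigma) => /injectiveP; apply.
Qed.

Definition hit sigma u : bool := [exists a, encode sigma a == u].

Lemma hit_encode sigma a : hit sigma (encode sigma a).
Proof. by apply/existsP; exists a. Qed.

Lemma decode_encode sigma a : decode sigma (encode sigma a) = Some a.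
Proof.
rewrite /decode; case: pickP => [b /eqP/encode_inj -> //|/(_ a)].
by rewrite eqxx.
Qed.

Lemma decode_miss sigma u : ~~ hit sigma u -> decode sigma u = None.
Proof.
rewrite /decode; case: pickP => // a /eqP <-.
by rewrite hit_encode.
Qed.

Lemma relabel_subproof (pi : {perm 'F_p})
    (rho : {perm (code_length p).-tuple bool}) sigma :
  injectiveb [ffun a => rho (val sigma (pi a))].
Proof.
apply/injectiveP => a b; rewrite !ffunE => /perm_inj.
by move: (valP sigma) => /injectiveP /[apply] /perm_inj.
Qed.

(** The symmetries of a uniform encoding. Two sets of encodings are compared below by an injection
    of this form from one into the other. *)
Definition relabel (pi : {perm 'F_p})
    (rho : {perm (code_length p).-tuple bool}) sigma : encoding p :=
  Sub [ffun a => rho (val sigma (pi a))] (relabel_subproof pi rho sigma).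

Lemma encode_relabel pi rho sigma a :
  encode (relabel pi rho sigma) a = rho (val sigma (pi a)).
Proof. by rewrite /encode /relabel SubK ffunE. Qed.

Lemma relabel_inj pi rho : injective (relabel pi rho).
Proof.
move=> s1 s2 /(congr1 val); rewrite !SubK => /ffunP eq12.
apply/val_inj/ffunP => a.
by have := eq12 (pi^-1%g a); rewrite !ffunE permKV => /perm_inj.
Qed.

Definition agrees xs zs us sigma : bool :=
  (map (encode sigma) xs == zs) && all (fun u => ~~ hit sigma u) us.

Definition agree_count xs zs us : nat := #|[pred sigma | agrees xs zs us sigma]|.

Lemma perm_map_uniq xs ys : uniq xs -> uniq ys -> size xs = size ys ->
  exists pi : {perm 'F_p}, map pi ys = xs.
Proof.
elim: xs ys => [|a xs IH] [|b ys] //=; first by exists 1%g.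
move=> /andP[axs uxs] /andP[bys uys] [/(IH _ uxs uys)[pi eq_pi]].
(* The transposition corrects the head and leaves the tail alone: neither [a] nor [pi b] is among
   the images [xs] of [ys]. *)
exists (pi * tperm (pi b) a)%g; rewrite permM tpermL; congr cons.
rewrite -[RHS]eq_pi; apply/eq_in_map => y yys; rewrite permM tpermD //.
  by apply: contraNneq bys => /perm_inj ->.
by apply: contraNneq axs => ->; rewrite -eq_pi map_f.
Qed.

(** A permutation of the exponents that carries [ys] to [xs] keeps the set of strings hit by the
    encoding, hence also the misses. *)
Lemma agree_count_le xs ys zs us : uniq xs -> uniq ys -> size xs = size ys ->
  (agree_count xs zs us <= agree_count ys zs us)%N.
Proof.
move=> uxs uys /(perm_map_uniq uxs uys)[pi eq_pi].
rewrite /agree_count -(card_imset [pred s | agrees xs zs us s] (@relabel_inj pi 1%g)).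
apply/subset_leq_card/subsetP.
move=> _ /imsetP[sigma sP ->]; move: sP; rewrite !inE => /andP[/eqP <- misses].
apply/andP; split.
  by rewrite -eq_pi -map_comp; apply/eqP/eq_map => y /=; rewrite encode_relabel perm1.
apply: sub_all misses => u; apply: contraNN => /existsP[a].
by rewrite encode_relabel perm1 => /eqP <-; rewrite hit_encode.
Qed.

Hypothesis p_pr : prime p.

(** By symmetry the count is the same for all distinct exponents, so it is taken at an arbitrary
    fixed choice; this makes it independent of the secrets. *)
Definition weight zs us : nat :=
  agree_count (take (size zs) (enum 'F_p)) zs us.

Lemma agree_count_weight xs zs us : uniq xs -> size xs = size zs ->
  agree_count xs zs us = weight zs us.
Proof.
move=> uxs sxs; have sz: (size zs <= size (enum 'F_p))%N.
  by rewrite -cardE -sxs -(card_uniqP uxs) max_card.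
have us' : uniq (take (size zs) (enum 'F_p)) by rewrite take_uniq ?enum_uniq.
by apply/eqP; rewrite eqn_leq !agree_count_le ?size_takel.
Qed.

Lemma agree_count_le_weight xs zs us : uniq zs ->
  (agree_count xs zs us <= weight zs us)%N.
Proof.
move=> uzs; have [/andP[/eqP sxs uxs]|Nxs] := boolP ((size xs == size zs) && uniq xs).
  by rewrite agree_count_weight.
rewrite /agree_count eq_card0 // => sigma; apply: contraNF Nxs.
rewrite inE => /andP[/eqP zsE _]; rewrite -zsE size_map eqxx /=.
by move: uzs; rewrite -zsE map_inj_uniq //; apply: encode_inj.
Qed.

Lemma agree_count0 xs zs us : uniq zs -> ~~ uniq xs -> agree_count xs zs us = 0%N.
Proof.
move=> uzs; apply: contraNeq; rewrite -lt0n => /card_gt0P[sigma].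
rewrite inE => /andP[/eqP zsE _].
by move: uzs; rewrite -zsE map_inj_uniq //; apply: encode_inj.
Qed.

(** The consistent encodings are sorted by the string they give to one further exponent, which
    exists because fewer than [p] are in use. *)
Lemma sum_weight_cons zs us : (size zs < p)%N ->
  (\sum_(z : (code_length p).-tuple bool) weight (val z :: zs) us
   = weight zs us)%N.
Proof.
move=> szs.
pose xs := take (size zs).+1 (enum 'F_p).
have sxs : size xs = (size zs).+1 by rewrite size_takel -?cardE ?card_Fp.
have uxs : uniq xs by rewrite take_uniq ?enum_uniq.
case: xs sxs uxs => // a xs [sxs] /= /andP[axs uxs].
rewrite -(agree_count_weight us uxs sxs) /agree_count -sum1_card.
rewrite (partition_big (fun sigma : encoding p => val sigma a) predT) //=.
apply: eq_bigr => z _; rewrite -(@agree_count_weight (a :: xs)) /= ?axs ?sxs //.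
rewrite /agree_count -sum1_card; apply: eq_bigl => sigma.
by rewrite !inE /agrees /= eqseq_cons [RHS]andbC andbA.
Qed.

Lemma code_length_ge : (p ^ 2 <= 2 ^ code_length p)%N.
Proof. by rewrite /code_length mulnC expnM leq_exp2r // up_logP. Qed.

(** Swapping the strings [u] and [v] preserves agreement, as neither occurs in [zs] or [us]. *)
Lemma hit_count_eq xs zs us (u v : (code_length p).-tuple bool) :
    val u \notin zs ++ us -> val v \notin zs ++ us ->
  (#|[pred sigma | agrees xs zs us sigma && hit sigma u]| <=
   #|[pred sigma | agrees xs zs us sigma && hit sigma v]|)%N.
Proof.
rewrite !mem_cat !negb_or => /andP[uzs uus] /andP[vzs vus].
rewrite -(card_imset [pred s | agrees xs zs us s && hit s u]
  (@relabel_inj 1%g (tperm u v))).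
apply/subset_leq_card/subsetP.
move=> _ /imsetP[sigma sP ->]; move: sP.
rewrite !inE => /andP[/andP[/eqP zsE misses] /existsP[a /eqP au]].
have au' : val sigma a = u by apply: val_inj.
apply/andP; split; last first.
  by apply/existsP; exists a; rewrite encode_relabel perm1 au' tpermL.
apply/andP; split.
  rewrite -zsE; apply/eqP/eq_in_map => b bxs.
  have bz : encode sigma b \in zs by rewrite -zsE map_f.
  rewrite encode_relabel perm1 tpermD //.
    by apply: contraNneq uzs => ->.
  by apply: contraNneq vzs => ->.
apply/allP => w wus; have /allP/(_ w wus) := misses.
apply: contraNN => /existsP[b /eqP]; rewrite encode_relabel perm1.
case: tpermP => [_ vw|_ uw|_ _ <-]; last exact: hit_encode.
  by move: vus; rewrite /= vw wus.
by move: uus; rewrite /= uw wus.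
Qed.

(* All strings outside [zs ++ us] are equally likely to be encodings, there are
   at least p^2 - p >= p^2/2 of them, and only p of them are encodings. *)
Lemma hit_count_le xs zs us u : uniq zs -> u \notin zs -> u \notin us ->
    (size zs + size us <= p)%N ->
  (p * #|[pred sigma | agrees xs zs us sigma && hit sigma u]|
   <= 2 * agree_count xs zs us)%N.
Proof.
move=> uzs u_zs u_us le_p.
set h := fun w => #|[pred sigma | agrees xs zs us sigma && hit sigma w]|.
rewrite -/(h u).
have [su|su] := eqVneq (size u) (code_length p); last first.
  suff -> : h u = 0%N by rewrite muln0.
  apply: eq_card0 => sigma; rewrite inE; apply/negbTE; rewrite negb_and.
  apply/orP; right; apply: contraNN su => /existsP[a /eqP <-].
  by rewrite size_tuple.
have [v vE] : exists v : (code_length p).-tuple bool, val v = u.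
  by have /eqP su' := su; exists (Tuple su').
have u_cat : val v \notin zs ++ us by rewrite vE mem_cat negb_or u_zs.
pose B := [pred z : (code_length p).-tuple bool | val z \notin zs ++ us].
(* Double counting of pairs of an agreeing encoding and a string it hits: each string of [B] is hit
   at least as often as [u], and each encoding hits exactly [p] strings. *)
have lB : (#|B| * h u <= p * agree_count xs zs us)%N.
  rewrite -sum_nat_const.
  apply: (@leq_trans (\sum_(z in B) h (val z))).
    by apply: leq_sum => z zB; rewrite -vE hit_count_eq.
  apply: (@leq_trans (\sum_(z : (code_length p).-tuple bool) h (val z))).
    by rewrite [leqRHS](bigID (mem B)) /= leq_addr.
  under eq_bigr do rewrite /h -sum1_card.
  rewrite (exchange_big_dep (fun sigma => agrees xs zs us sigma)) /=; last first.
    by move=> z sigma _; rewrite inE => /andP[].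
  rewrite /agree_count mulnC -sum_nat_const; apply: leq_sum => sigma sP.
  have codomE : #|codom (val sigma)| = p.
    by rewrite card_codom ?card_Fp //; apply/injectiveP; apply: (valP sigma).
  rewrite sum1_card -[leqRHS]codomE; apply/subset_leq_card/subsetP => z.
  rewrite unfold_in => /andP[_ /existsP[a /eqP az]].
  by apply/codomP; exists a; apply: val_inj.
have cB : (2 ^ code_length p <= #|B| + p)%N.
  have <- : #|{: (code_length p).-tuple bool}| = (2 ^ code_length p)%N.
    by rewrite card_tuple card_bool.
  rewrite -(cardC B) leq_add2l; apply: leq_trans le_p; rewrite -size_cat.
  rewrite cardE -(size_map val) uniq_leq_size //.
    by rewrite (map_inj_uniq val_inj) enum_uniq.
  by move=> w /mapP[z + ->]; rewrite mem_enum !inE negbK.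
have := code_length_ge; have := prime_gt1 p_pr.
move: (2 ^ _)%N #|B| (h u) (agree_count _ _ _) lB cB => l b x g lB cB p1 pl.
have b2 : (p * p <= 2 * b)%N.
  by have := leq_mul p1 (leqnn p); rewrite -mulnn in pl; lia.
have : (p * (p * x) <= p * (2 * g))%N by have := leq_mul b2 (leqnn x); lia.
rewrite leq_pmul2l //; lia.
Qed.

End Encodings.

(** * The generic-group game *)

(* With the number of queries cut off, the induction on the game needs no bound on
   the queries made at points and encodings that are not reached. *)
Fixpoint run_upto (q : nat) (t : strategy) (O : oracle) : bool :=
  match t with
  | Return b => b
  | Query w1 w2 op next =>
      if q is q'.+1 then run_upto q' (next (O w1 w2 op)) O else false
  end.

Lemma run_uptoE (q : nat) (t : strategy) (O : oracle) :
  (query_count t O <= q)%N -> run_upto q t O = run t O.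
Proof. by elim: q t => [|q IH] [b|w1 w2 op next] //=; apply: IH. Qed.

Section Game.

Variables (R : realFieldType) (p n : nat).
Hypothesis p_pr : prime p.

Definition ev (v : 'cV['F_p]_n) (f : 'rV['F_p]_n) : 'F_p := (f *m v) 0 0.

Lemma evD v f g : ev v (f + g) = ev v f + ev v g.
Proof. by rewrite /ev mulmxDl mxE. Qed.

Lemma evB v f g : ev v (f - g) = ev v f - ev v g.
Proof. by rewrite /ev mulmxBl !mxE. Qed.

Variables (Omega : finType) (x : bool -> Omega -> 'cV['F_p]_n) (eps : R).
Hypothesis eps_ge0 : 0 <= eps.
Hypothesis root_prob : forall b f, f != 0 ->
  #|[pred o | ev (x b o) f == 0]|%:R <= eps * #|Omega|%:R.

Implicit Types (b : bool) (o : Omega) (f g : 'rV['F_p]_n) (fs gs : seq 'rV['F_p]_n).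
Implicit Types (zs us : seq bitstring) (sigma : encoding p).
Implicit Types (H : 'cV['F_p]_n -> encoding p -> R) (e : R).

(** An unnormalised expectation over uniform [o] and [sigma], restricted to one view of the
    adversary; no division by the probability of the view is needed. If the forms never collided,
    the total mass would be [#|Omega|] times [weight p zs us], the scale against which differences
    are measured. *)
Definition mass b fs zs us H : R :=
  \sum_o \sum_(sigma | agrees (map (ev (x b o)) fs) zs us sigma) H (x b o) sigma.

(* The handles [zs] of the forms [fs], and the strings [us] known not to be
   handles, are everything the adversary has learnt so far. *)
Definition close fs zs us H e : Prop :=
  `|mass false fs zs us H - mass true fs zs us H|
    <= e * (#|Omega|%:R * (weight p zs us)%:R).

Definition unit_valued H : Prop := forall v sigma, 0 <= H v sigma <= 1.

Lemma scale_ge0 zs us : 0 <= #|Omega|%:R * (weight p zs us)%:R :> R.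
Proof. by rewrite mulr_ge0. Qed.

Lemma closeW fs zs us H e e' : e <= e' ->
  close fs zs us H e -> close fs zs us H e'.
Proof.
by move=> le_e /le_trans; apply; rewrite ler_wpM2r // scale_ge0.
Qed.

Lemma eq_close fs zs us H H' e :
  (forall v sigma, agrees (map (ev v) fs) zs us sigma -> H v sigma = H' v sigma) ->
  close fs zs us H' e -> close fs zs us H e.
Proof.
move=> eqH; have eqm b : mass b fs zs us H = mass b fs zs us H'.
  by apply: eq_bigr => o _; apply: eq_bigr => sigma; apply: eqH.
by rewrite /close !eqm.
Qed.

(** Union bound: a collision of [f] with [g] is a root of the nonzero form [f - g]. *)
Lemma collision_prob b f fs : f \notin fs ->
  #|[pred o | ev (x b o) f \in map (ev (x b o)) fs]|%:R
    <= (size fs)%:R * eps * #|Omega|%:R.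
Proof.
elim: fs => [_|g fs IH] /=.
  by rewrite !mul0r eq_card0.
rewrite inE negb_or => /andP[neq_fg /IH{}IH].
have fg : f - g != 0 by rewrite subr_eq0.
have := root_prob b fg; rewrite -natr1 mulrDl mulrDl mul1r.
set B := [pred o | _] => leB; set C := [pred o | _].
set D := [pred o | _] in IH.
apply: (@le_trans _ _ (#|B|%:R + #|D|%:R)); last by rewrite addrC lerD.
rewrite -natrD ler_nat -cardUI; apply: leq_trans (leq_addr _ _).
by apply/subset_leq_card/subsetP => o; rewrite !inE evB subr_eq0.
Qed.

Lemma not_uniq_prob b fs : uniq fs ->
  #|[pred o | ~~ uniq (map (ev (x b o)) fs)]|%:R
    <= (size fs)%:R ^+ 2 * eps * #|Omega|%:R.
Proof.
elim: fs => [_|f fs IH /andP[ffs /IH{}IH]]; first by rewrite expr0n !mul0r eq_card0.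
have := collision_prob b ffs.
set B := [pred o | _] => leB; set C := [pred o | _].
set D := [pred o | _] in IH.
apply: (@le_trans _ _ (#|B|%:R + #|D|%:R)).
  rewrite -natrD ler_nat -cardUI; apply: leq_trans (leq_addr _ _).
  by apply/subset_leq_card/subsetP => o; rewrite !inE /= negb_and negbK.
apply: le_trans (lerD leB IH) _; rewrite -!mulrDl; do 2 apply: ler_wpM2r => //.
rewrite /= -natr1; have : 0 <= (size fs)%:R :> R by [].
nra.
Qed.

(** Where two forms collide no injection can produce distinct handles; elsewhere the number of
    agreeing encodings is the weight, whatever the values are. *)
Lemma mass_const b fs zs us (c : R) : uniq zs -> size fs = size zs ->
  mass b fs zs us (fun _ _ => c)
  = c * (#|[pred o | uniq (map (ev (x b o)) fs)]|%:R * (weight p zs us)%:R).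
Proof.
move=> uzs sfs; rewrite /mass (bigID (fun o => uniq (map (ev (x b o)) fs))) /=.
rewrite [X in _ + X]big1 ?addr0 => [|o Nu]; last first.
  have := agree_count0 us uzs Nu.
  by rewrite sumr_const /agree_count => ->.
rewrite -sum1_card natr_sum mulr_suml mulr_sumr; apply: eq_bigr => o u.
rewrite sumr_const mul1r -[X in _ *+ X]/(agree_count _ zs us).
by rewrite (agree_count_weight _ u) ?size_map // mulr_natr.
Qed.

(** The end of the game: with a fixed output, the messages differ only in how often the forms
    collide. *)
Lemma close_const fs zs us (c : R) : 0 <= c <= 1 ->
    uniq fs -> uniq zs -> size fs = size zs ->
  close fs zs us (fun _ _ => c) ((size fs)%:R ^+ 2 * eps).
Proof.
move=> /andP[c0 c1] ufs uzs sfs; rewrite /close !mass_const //.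
rewrite -mulrBr -mulrBl normrM (ger0_norm c0) normrM [X in _ * (_ * X)]ger0_norm //.
apply: (@le_trans _ _ (1 * (((size fs)%:R ^+ 2 * eps * #|Omega|%:R) * (weight p zs us)%:R))).
  apply: ler_pM; rewrite ?mulr_ge0 //.
  apply: ler_wpM2r => //.
  have E b : #|[pred o | uniq (map (ev (x b o)) fs)]|%:R =
      #|Omega|%:R - #|[pred o | ~~ uniq (map (ev (x b o)) fs)]|%:R :> R.
    rewrite -(cardC [pred o | uniq (map (ev (x b o)) fs)]) natrD.
    by rewrite [X in _ + X%:R - _](@eq_card _ _ [pred o | ~~ uniq (map (ev (x b o)) fs)]) ?addrK.
  have := not_uniq_prob true ufs; have := not_uniq_prob false ufs; rewrite !E.
  set B := _ * _ * _; set c0' := #|_|; set c1' := #|_|; set O := #|_|.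
  have := ler0n R c0'; have := ler0n R c1'.
  move: B c0' c1' O => B a a' O ? ? ? ?.
  by rewrite ler_norml; apply/andP; split; lra.
by rewrite mul1r !mulrA.
Qed.

Lemma mass_part_le b fs zs us H (P : pred Omega) : unit_valued H -> uniq zs ->
  \sum_(o | P o) \sum_(sigma | agrees (map (ev (x b o)) fs) zs us sigma)
    H (x b o) sigma <= #|P|%:R * (weight p zs us)%:R.
Proof.
move=> H01 uzs; rewrite -sum1_card natr_sum mulr_suml; apply: ler_sum => o _.
apply: (@le_trans _ _ (agree_count (map (ev (x b o)) fs) zs us)%:R).
  rewrite /agree_count -sum1_card natr_sum; apply: ler_sum => sigma _.
  by have /andP[] := H01 (x b o) sigma.
by rewrite mul1r ler_nat agree_count_le_weight.
Qed.

Lemma dist_itv (a b c : R) : 0 <= a <= c -> 0 <= b <= c -> `|a - b| <= c.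
Proof. by move=> /andP[? ?] /andP[? ?]; rewrite ler_norml; apply/andP; split; lra. Qed.

(** One step in which the handle of a new form is shown. It repeats an old handle only if the form
    collides with an earlier one; otherwise the view grows by a fresh handle. *)
Lemma close_reveal f fs zs us (H : bitstring -> 'cV['F_p]_n -> encoding p -> R) e :
    0 <= e -> (forall z, unit_valued (H z)) ->
    f \notin fs -> uniq zs -> (size zs < p)%N ->
    (forall z, z \notin zs -> close (f :: fs) (z :: zs) us (H z) e) ->
  close fs zs us (fun v sigma => H (encode sigma (ev v f)) v sigma)
    (e + (size fs)%:R * eps).
Proof.
move=> e0 H01 ffs uzs szs closeH; rewrite /close.
set H' := fun v sigma => _.
have H'01 : unit_valued H' by move=> v sigma; apply: H01.
pose stale (b : bool) o sigma := encode sigma (ev (x b o) f) \in zs.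
pose near b := \sum_o \sum_(sigma | agrees (map (ev (x b o)) fs) zs us sigma &&
  stale b o sigma) H' (x b o) sigma.
pose far b := \sum_(z : (code_length p).-tuple bool | val z \notin zs)
  mass b (f :: fs) (val z :: zs) us (H z).
have massE b : mass b fs zs us H' = near b + far b.
  rewrite /far exchange_big /= -big_split /=; apply: eq_bigr => o _.
  rewrite (bigID (stale b o)) /=; congr (_ + _).
  rewrite (partition_big (fun sigma : encoding p => val sigma (ev (x b o) f))
    (fun z => val z \notin zs)) /=; last by move=> sigma /andP[].
  apply: eq_bigr => z zzs; apply: eq_big => [sigma|sigma].
    rewrite /agrees /= eqseq_cons /stale.
    have -> : (encode sigma (ev (x b o) f) == tval z) =
      (val sigma (ev (x b o) f) == z) by [].
    case: (val sigma _ =P z) => [zE|_]; rewrite ?andbF //.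
    have -> : encode sigma (ev (x b o) f) = val z by rewrite /encode zE.
    by rewrite zzs !andbT.
  by move=> /andP[_ /eqP zE]; rewrite /H' /encode zE.
have near_itv b : 0 <= near b <= (size fs)%:R * eps * (#|Omega|%:R * (weight p zs us)%:R).
  apply/andP; split.
    apply: sumr_ge0 => o _; apply: sumr_ge0 => sigma _.
    by have /andP[] := H'01 (x b o) sigma.
  pose P := [pred o | ev (x b o) f \in map (ev (x b o)) fs].
  apply: (@le_trans _ _ (\sum_(o | P o) \sum_(sigma | agrees (map (ev (x b o)) fs) zs us sigma)
    H' (x b o) sigma)).
    rewrite [leRHS]big_mkcond /=; apply: ler_sum => o _; case: ifPn => Po.
      rewrite [leRHS](bigID (stale b o)) /= lerDl; apply: sumr_ge0 => sigma _.
      by have /andP[] := H'01 (x b o) sigma.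
    (* Where the value of [f] is new, injectivity makes its handle new, so nothing is stale. *)
    rewrite big1 // => sigma /andP[/andP[/eqP zsE _]].
    by rewrite /stale -zsE mem_map; [rewrite (negbTE Po)|apply: encode_inj].
  apply: le_trans (mass_part_le _ _ _ _ H'01 uzs) _.
  by rewrite !mulrA; apply: ler_wpM2r => //; apply: collision_prob.
rewrite !massE opprD addrACA mulrDl addrC; apply: le_trans (ler_normD _ _) _.
apply: lerD; last exact: dist_itv.
rewrite /far -sumrB; apply: le_trans (ler_norm_sum _ _ _) _.
apply: (@le_trans _ _ (\sum_(z : (code_length p).-tuple bool | val z \notin zs)
   e * (#|Omega|%:R * (weight p (val z :: zs) us)%:R))).
  by apply: ler_sum => z zzs; apply: closeH.
rewrite -!mulr_sumr; do 2 apply: ler_wpM2l => //.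
(* Over all next handles the weights add up to at most the old weight, so the error [e] does not
   multiply. *)
rewrite -(sum_weight_cons p_pr us szs) natr_sum.
rewrite [leRHS](bigID (fun z : (code_length p).-tuple bool => val z \notin zs)) /=.
by rewrite lerDl sumr_ge0.
Qed.

(** One step in which an unknown string is submitted. It is an encoding with probability at most
    [2 / p] given the view; otherwise it joins the known misses. *)
Lemma close_miss u fs zs us H H' e :
    0 <= e -> unit_valued H ->
    (forall v sigma, ~~ hit sigma u -> H v sigma = H' v sigma) ->
    u \notin zs -> u \notin us -> uniq zs -> (size zs + size us <= p)%N ->
    close fs zs (u :: us) H' e ->
  close fs zs us H (e + 2 / p%:R).
Proof.
move=> e0 H01 eqH u_zs u_us uzs le_p; rewrite /close.
pose lucky b := \sum_o \sum_(sigma | agrees (map (ev (x b o)) fs) zs us sigma &&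
  hit sigma u) H (x b o) sigma.
have massE b : mass b fs zs us H = lucky b + mass b fs zs (u :: us) H'.
  rewrite /mass -big_split /=; apply: eq_bigr => o _.
  rewrite (bigID (fun sigma => hit sigma u)) /=; congr (_ + _).
  apply: eq_big => [sigma|sigma /andP[_ /eqH->] //].
  by rewrite /agrees /= -andbA; congr (_ && _); rewrite andbC.
have p0 : 0 < p%:R :> R by rewrite ltr0n prime_gt0.
have lucky_itv b : 0 <= lucky b <= 2 / p%:R * (#|Omega|%:R * (weight p zs us)%:R).
  apply/andP; split.
    apply: sumr_ge0 => o _; apply: sumr_ge0 => sigma _.
    by have /andP[] := H01 (x b o) sigma.
  rewrite mulrCA -sum1_card natr_sum mulr_suml; apply: ler_sum => o _.
  set xs := map _ fs; rewrite mul1r.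
  apply: (@le_trans _ _ (#|[pred sigma | agrees xs zs us sigma && hit sigma u]|%:R)).
    rewrite -sum1_card natr_sum; apply: ler_sum => sigma _.
    by have /andP[] := H01 (x b o) sigma.
  rewrite mulrAC ler_pdivlMr // -natrM -natrM ler_nat mulnC.
  apply: leq_trans (hit_count_le p_pr _ uzs u_zs u_us le_p) _.
  by rewrite leq_mul2l /= agree_count_le_weight.
rewrite !massE opprD addrACA mulrDl addrC => closeH.
apply: le_trans (ler_normD _ _) _; apply: lerD; last exact: dist_itv.
(* One more excluded string can only lower the weight. *)
apply: le_trans closeH _; do 2 apply: ler_wpM2l => //.
rewrite ler_nat; apply/subset_leq_card/subsetP => sigma.
by rewrite !inE /agrees /= => /andP[-> /andP[]].
Qed.

Lemma agrees_nth v fs zs us sigma z : size fs = size zs ->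
    agrees (map (ev v) fs) zs us sigma -> z \in zs ->
  z = encode sigma (ev v (nth 0 fs (index z zs))).
Proof.
move=> sfs /andP[/eqP zsE _] zzs; rewrite -[LHS](nth_index [::] zzs) -{1}zsE.
by rewrite (nth_map 0) ?(nth_map 0) ?size_map ?sfs ?index_mem.
Qed.

Section Run.

Variable T : nat.
Hypothesis le_Tp : (T <= p)%N.

(** The first term pays for collisions among the final forms; each of the [q] remaining steps pays
    for a collision of a new form and for a lucky guess. [T] bounds the size of every view. *)
Definition error (q : nat) : R :=
  T%:R ^+ 2 * eps + q%:R * (T%:R * eps + 2 / p%:R).

Lemma error_step_ge0 : 0 <= T%:R * eps + 2 / p%:R.
Proof. by rewrite addr_ge0 // mulr_ge0 // invr_ge0. Qed.

Lemma error_ge0 q : 0 <= error q.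
Proof. by rewrite addr_ge0 ?mulr_ge0 ?exprn_ge0 ?error_step_ge0. Qed.

Lemma errorS q : error q.+1 = error q + (T%:R * eps + 2 / p%:R).
Proof. by rewrite /error -natr1 mulrDl mul1r addrA. Qed.

Lemma error_le q : error q <= error q.+1.
Proof. by rewrite errorS lerDl error_step_ge0. Qed.

Lemma error_reveal q fs : (size fs <= T)%N -> error q + (size fs)%:R * eps <= error q.+1.
Proof.
move=> sfs; rewrite errorS lerD2l; apply: ler_wpDr; first by rewrite divr_ge0.
by rewrite ler_wpM2r // ler_nat.
Qed.

Lemma error_miss q : error q + 2 / p%:R <= error q.+1.
Proof. by rewrite errorS lerD2l lerDr mulr_ge0. Qed.

Lemma unit_bool (c : bool) : 0 <= (c%:R : R) <= 1.
Proof. by case: c; rewrite ler01 lexx. Qed.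

Lemma close_bool (c : bool) q fs zs us : uniq fs -> uniq zs -> size fs = size zs ->
  (size zs <= T)%N -> close fs zs us (fun _ _ => c%:R) (error q).
Proof.
move=> ufs uzs sfs szs; apply: closeW (close_const us (unit_bool c) ufs uzs sfs).
apply: ler_wpDr; first by rewrite mulr_ge0 ?error_step_ge0.
by rewrite ler_wpM2r // lerXn2r ?nnegrE // ler_nat sfs.
Qed.

(** A form already in the view has a known handle and its answer carries no information; only a new
    form costs anything. *)
Lemma close_answer f fs zs us (H : bitstring -> 'cV['F_p]_n -> encoding p -> R) q :
    (forall z, unit_valued (H z)) ->
    uniq fs -> uniq zs -> size fs = size zs -> (size zs < T)%N ->
    (forall z, f \in fs -> z \in zs -> close fs zs us (H z) (error q)) ->
    (forall z, f \notin fs -> z \notin zs ->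
      close (f :: fs) (z :: zs) us (H z) (error q)) ->
  close fs zs us (fun v sigma => H (encode sigma (ev v f)) v sigma) (error q.+1).
Proof.
move=> H01 ufs uzs sfs szs old new.
have [ffs|ffs] := boolP (f \in fs); last first.
  have szT : (size fs <= T)%N by rewrite sfs ltnW.
  apply: closeW (error_reveal q szT) _.
  by apply: close_reveal => //; [apply: error_ge0|apply: leq_trans szs le_Tp|move=> z; apply: new].
have iz : (index f fs < size zs)%N by rewrite -sfs index_mem.
apply: closeW (error_le q) _.
(* On this view the answer is the handle stored at the index of [f]. *)
apply: eq_close (old (nth [::] zs (index f fs)) ffs (mem_nth _ iz)) => v sigma agr.
congr (H _ v sigma); rewrite [RHS](agrees_nth sfs agr) ?mem_nth //.
by rewrite index_uniq // nth_index.
Qed.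

(** Induction on the remaining budget. A query adds at most one entry to [zs] or [us] and uses one
    unit of [q], so the total stays below [T]. *)
Lemma close_run q t fs zs us :
    uniq fs -> uniq zs -> size fs = size zs -> (size zs + size us + q <= T)%N ->
  close fs zs us (fun _ sigma => (run_upto q t (group_oracle sigma))%:R) (error q).
Proof.
elim: q t fs zs us => [|q IH] [c|w1 w2 op next] fs zs us ufs uzs sfs szT /=.
- by apply: close_bool => //; lia.
- by apply: (close_bool false) => //; lia.
- by apply: close_bool => //; lia.
have H01 t : unit_valued (fun _ sigma => (run_upto q t (group_oracle sigma))%:R).
  by move=> v sigma; apply: unit_bool.
have [w1z|w1z] := boolP (w1 \in zs); last first.
  have missE sigma : ~~ hit sigma w1 -> group_oracle sigma w1 w2 op = None.
    by move=> /decode_miss; rewrite /group_oracle => ->.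
  (* A string known to be invalid is answered by bottom on the whole view, at no cost. *)
  have [w1u|w1u] := boolP (w1 \in us).
    apply: closeW (error_le q) _.
    apply: eq_close (IH (next None) fs zs us ufs uzs sfs _) => [v sigma|]; last by lia.
    by move=> /andP[_ /allP/(_ _ w1u)/missE ->].
  apply: closeW (error_miss q) _.
  apply: (close_miss (error_ge0 q) _ _ w1z w1u uzs _
    (IH (next None) fs zs (w1 :: us) ufs uzs sfs _)) => [v sigma|v sigma /missE-> //||] /=.
  - exact: unit_bool.
  - by lia.
  - by lia.
have [w2z|w2z] := boolP (w2 \in zs); last first.
  have missE sigma : ~~ hit sigma w2 -> group_oracle sigma w1 w2 op = None.
    by move=> /decode_miss; rewrite /group_oracle => ->; case: (decode _ _).
  have [w2u|w2u] := boolP (w2 \in us).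
    apply: closeW (error_le q) _.
    apply: eq_close (IH (next None) fs zs us ufs uzs sfs _) => [v sigma|]; last by lia.
    by move=> /andP[_ /allP/(_ _ w2u)/missE ->].
  apply: closeW (error_miss q) _.
  apply: (close_miss (error_ge0 q) _ _ w2z w2u uzs _
    (IH (next None) fs zs (w2 :: us) ufs uzs sfs _)) => [v sigma|v sigma /missE-> //||] /=.
  - exact: unit_bool.
  - by lia.
  - by lia.
(* Both operands are known handles, so the answer encodes the sum or difference of their forms. *)
pose f1 := nth 0 fs (index w1 zs); pose f2 := nth 0 fs (index w2 zs).
pose f := match op with AddInstr => f1 + f2 | SubInstr => f1 - f2 end.
apply: (@eq_close _ _ _ _ (fun v sigma =>
  (run_upto q (next (Some (encode sigma (ev v f)))) (group_oracle sigma))%:R)).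
  move=> v sigma agr; congr (run_upto q (next _) _)%:R.
  rewrite /group_oracle [w1 in LHS](agrees_nth sfs agr w1z).
  rewrite [w2 in LHS](agrees_nth sfs agr w2z) !decode_encode /f.
  by case: (op); rewrite (evB, evD).
apply: (@close_answer f fs zs us (fun z _ sigma =>
  (run_upto q (next (Some z)) (group_oracle sigma))%:R)) => // [|z _ _|z ffs zzs].
- by lia.
- by apply: IH => //; lia.
- by apply: IH; rewrite /= ?ffs ?zzs ?sfs //; lia.
Qed.

(** The ciphertext is treated as a list of answers revealed one at a time before the first query;
    [K] is the adversary as a function of them. *)
Lemma close_transcript gs (K : seq bitstring -> strategy) q fs zs us :
    uniq fs -> uniq zs -> size fs = size zs ->
    (size zs + size us + (size gs + q) <= T)%N ->
  close fs zs us (fun v sigma =>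
    (run_upto q (K [seq encode sigma (ev v g) | g <- gs]) (group_oracle sigma))%:R)
    (error (size gs + q)).
Proof.
elim: gs K fs zs us => [|g gs IH] K fs zs us ufs uzs sfs /= szT.
  exact: close_run.
apply: (@close_answer g fs zs us (fun z v sigma =>
  (run_upto q (K (z :: [seq encode sigma (ev v g) | g <- gs])) (group_oracle sigma))%:R))
  => // [z v sigma||z _ _|z gfs zzs].
- exact: unit_bool.
- by lia.
- by apply: (IH (fun l => K (z :: l))) => //; lia.
- by apply: (IH (fun l => K (z :: l))); rewrite /= ?gfs ?zzs ?sfs //; lia.
Qed.

End Run.

Lemma generic_advantage gs (K : seq bitstring -> strategy) q :
    (size gs + q <= p)%N ->
  let accept b o sigma :=
    (run_upto q (K [seq encode sigma (ev (x b o) g) | g <- gs]) (group_oracle sigma))%:R in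
  `|\sum_o \sum_sigma accept false o sigma - \sum_o \sum_sigma accept true o sigma|
    <= error (size gs + q) (size gs + q) * (#|Omega| * #|encoding p|)%:R :> R.
Proof.
move=> le_p /=.
(* The game starts from the empty view, with which all encodings agree. *)
have := @close_transcript _ le_p gs K q [::] [::] [::] isT isT erefl (leqnn _).
rewrite /close /mass natrM; set e := error _ _; set O := #|Omega|%:R.
have -> : weight p [::] [::] = #|encoding p|.
  by apply: eq_card => sigma; rewrite !inE /agrees take0.
suff agr b o (F : encoding p -> R) :
    \sum_(sigma | agrees (map (ev (x b o)) [::]) [::] [::] sigma) F sigma = \sum_sigma F sigma.
  have E b : \sum_o \sum_(sigma | agrees (map (ev (x b o)) [::]) [::] [::] sigma)
      (run_upto q (K [seq encode sigma (ev (x b o) g) | g <- gs]) (group_oracle sigma))%:R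
    = \sum_o \sum_sigma
      (run_upto q (K [seq encode sigma (ev (x b o) g) | g <- gs]) (group_oracle sigma))%:R :> R.
    by apply: eq_bigr => o _; apply: agr.
  by rewrite !E.
by apply: eq_bigl.
Qed.

End Game.

(** * Vanishing of linear forms at the secrets *)

Section Counting.

Variable p : nat.
Hypothesis p_pr : prime p.

Definition natcol (n b : nat) (v : {ffun 'I_n -> 'I_b}) : 'cV['F_p]_n :=
  \col_i (v i)%:R.

Lemma natr_Fp_inj (i j : nat) : (i < p)%N -> (j < p)%N ->
  i%:R = j%:R :> 'F_p -> i = j.
Proof.
move=> ip jp /(congr1 val); rewrite /= !val_Fp_nat //.
by rewrite !modn_small.
Qed.

(* A solution is determined by its coordinates outside [\rank M] independent
   columns of M, so overwriting the others arbitrarily loses no information. *)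
Lemma card_solutions (n q b : nat) (M : 'M['F_p]_(q, n)) (c : 'cV['F_p]_q) :
    (b <= p)%N ->
  (#|[pred v : {ffun 'I_n -> 'I_b} | M *m natcol v == c]| * b ^ \rank M <= b ^ n)%N.
Proof.
move=> bp; pose f := maxrankfun M^T.
pose overwrite (vw : {ffun 'I_n -> 'I_b} * {ffun 'I_(\rank M^T) -> 'I_b}) :=
  [ffun i => if [pick j | f j == i] is Some j then vw.2 j else vw.1 i].
have f_inj : injective f by apply: maxrankfun_inj.
have overwriteE vw j : overwrite vw (f j) = vw.2 j.
  rewrite ffunE; case: pickP => [j' /eqP/f_inj -> //|/(_ j)]; by rewrite eqxx.
pose S := [pred v : {ffun 'I_n -> 'I_b} | M *m natcol v == c].
have inj : {in [pred vw | vw.1 \in S] &, injective overwrite}.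
  move=> [v w] [v' w']; rewrite !inE /= => /eqP Mv /eqP Mv' eq_ov.
  have eq_w : w = w' by apply/ffunP => j; rewrite -[w j](overwriteE (v, w)) eq_ov overwriteE.
  suff eq_v : v = v' by rewrite eq_v eq_w.
  have off i : i \notin codom f -> v i = v' i.
    move=> /codomP if_; have /ffunP/(_ i) := eq_ov; rewrite !ffunE.
    by case: pickP => // j /eqP fj; case: if_; exists j.
  have [D D_def] : exists D, D = natcol v - natcol v' by exists (natcol v - natcol v').
  have D0 i : i \notin codom f -> D i 0 = 0.
    by move=> /off eq_i; rewrite D_def !mxE eq_i subrr.
  have MD : M *m D = 0 by rewrite D_def mulmxBr Mv Mv' subrr.
  have /row_free_inj : row_free (rowsub f M^T) by apply: maxrowsub_free.
  move=> free_sub.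
  (* The difference [D] is supported on the chosen columns, so [M *m D = 0] is a linear relation
     among independent columns of [M]. *)
  have /free_sub DE : (\row_j D (f j) 0) *m rowsub f M^T = 0 *m rowsub f M^T.
    rewrite mul0mx -[RHS]trmx0 -MD trmx_mul; apply/matrixP => i k; rewrite (ord1 i) !mxE.
    rewrite [RHS](bigID (mem (codom f))) /= [X in _ + X]big1 => [|i' /D0 D0']; last first.
      by rewrite mxE D0' mul0r.
    rewrite addr0 -big_uniq /=; last exact/injectiveP.
    rewrite /codom big_image /=.
    by apply: eq_bigr => j _; rewrite !mxE.
  apply/ffunP => i; apply: val_inj => /=.
  have [/codomP[j ->]|/off -> //] := boolP (i \in codom f).
  have /rowP/(_ j) := DE; rewrite D_def !mxE => /eqP; rewrite subr_eq0 => /eqP.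
  (* Equality in the field gives equality of the integers because [b <= p]. *)
  by apply: natr_Fp_inj; apply: leq_trans (ltn_ord _) bp.
have := card_in_imset inj; rewrite -(mxrank_tr M).
have -> : #|[pred vw : {ffun 'I_n -> 'I_b} * {ffun 'I_(\rank M^T) -> 'I_b} | vw.1 \in S]|
   = (#|S| * b ^ \rank M^T)%N.
  have <- : #|{: {ffun 'I_(\rank M^T) -> 'I_b}}| = (b ^ \rank M^T)%N.
    by rewrite card_ffun !card_ord.
  rewrite -cardX; apply: eq_card => -[v w]; by rewrite !inE andbT.
move=> <-; have <- : #|{: {ffun 'I_n -> 'I_b}}| = (b ^ n)%N by rewrite card_ffun !card_ord.
exact: max_card.
Qed.

Lemma card_hyperplane (n : nat) (a : 'rV['F_p]_n) (c : 'F_p) : a != 0 ->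
  (#|[pred v : {ffun 'I_n -> 'I_p} | (a *m natcol v)%R 0%R 0%R == c]| * p <= p ^ n)%N.
Proof.
move=> a0; have := @card_solutions n 1 p a c%:M (leqnn p).
rewrite rank_rV a0 expn1; congr (_ * _ <= _)%N; apply: eq_card => v; rewrite !inE.
apply/eqP/eqP => [->|eq_c]; first by rewrite mxE.
by rewrite [LHS]mx11_scalar eq_c.
Qed.

End Counting.

Lemma card_triple3 (A B C : finType) (P : pred (A * B * C)) :
  #|P| = (\sum_a \sum_b #|[pred c | P (a, b, c)]|)%N.
Proof.
pose F a b c : nat := P (a, b, c).
transitivity (\sum_(o : A * B * C) F o.1.1 o.1.2 o.2)%N.
  rewrite -sum1_card big_mkcond; apply: eq_bigr => -[[a b] c] _.
  by rewrite unfold_in /F /=; case: (P _).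
rewrite -(pair_bigA _ (fun ab c => F ab.1 ab.2 c)) /=.
rewrite -(pair_bigA _ (fun a b => \sum_c F a b c)%N) /=.
apply: eq_bigr => a _; apply: eq_bigr => b _.
rewrite -sum1_card [RHS]big_mkcond; apply: eq_bigr => c _.
by rewrite unfold_in /F /=; case: (P _).
Qed.

Lemma card_triple1 (A B C : finType) (P : pred (A * B * C)) :
  #|P| = (\sum_b \sum_c #|[pred a | P (a, b, c)]|)%N.
Proof.
rewrite card_triple3 exchange_big; apply: eq_bigr => b _.
under eq_bigr do rewrite -sum1_card big_mkcond.
rewrite exchange_big; apply: eq_bigr => c _.
by rewrite -sum1_card [RHS]big_mkcond.
Qed.

Section Secrets.

Variables (p m d : nat) (Ms : seq 'M['F_p]_m).
Hypothesis p_pr : prime p.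
Hypothesis m_gt0 : (0 < m)%N.
Hypothesis m_le : (m <= p)%N.
Hypothesis Ms_free : free Ms.
Hypothesis Ms_rank : forall M, M \in <<Ms>>%VS -> M != 0 -> (d <= \rank M)%N.

Local Notation k := (size Ms).

Definition secrets : finType :=
  ({ffun 'I_m -> 'I_p} * {ffun 'I_m -> 'I_m} * {ffun 'I_k -> 'I_p})%type.

(** Both messages share one space of secrets; the component [o.2] is drawn in both cases, as in the
    scheme. *)
Definition exponents (beta : bool) (o : secrets) : 'cV['F_p]_k :=
  \col_j if beta then (o.2 j)%:R
         else ((natcol p o.1.1)^T *m Ms`_j *m natcol p o.1.2) 0 0.

(* Every group element in the ciphertext is the image under the encoding of one
   coordinate of this vector. *)
Definition point (beta : bool) (o : secrets) : 'cV['F_p]_(1 + (m + k)) :=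
  col_mx 1%:M (col_mx (natcol p o.1.1) (exponents beta o)).

Lemma card_secrets : #|secrets| = (p ^ m * m ^ m * p ^ k)%N.
Proof. by rewrite !card_prod !card_ffun !card_ord. Qed.

Lemma ev_point beta o (c : 'rV['F_p]_1) (a : 'rV['F_p]_m) (b : 'rV['F_p]_k) :
  ev (point beta o) (row_mx c (row_mx a b)) =
  c 0 0 + ((a *m natcol p o.1.1) 0 0 + (b *m exponents beta o) 0 0).
Proof. by rewrite /ev /point !mul_row_col mulmx1 !mxE. Qed.

Definition combination (b : 'rV['F_p]_k) : 'M['F_p]_m :=
  \sum_j b 0 j *: Ms`_j.

Lemma ev_point_real o (c : 'rV['F_p]_1) (a : 'rV['F_p]_m) (b : 'rV['F_p]_k) :
  ev (point false o) (row_mx c (row_mx a b)) =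
  c 0 0 + ((a + (combination b *m natcol p o.1.2)^T) *m natcol p o.1.1) 0 0.
Proof.
rewrite ev_point mulmxDl [X in _ = _ + X]mxE; congr (_ + (_ + _)).
rewrite -[natcol p o.1.1 in RHS]trmxK -trmx_mul [RHS]mxE mulmxA.
rewrite /combination mulmx_sumr mulmx_suml summxE mxE.
by apply: eq_bigr => j _; rewrite -scalemxAr -scalemxAl [RHS]mxE mxE.
Qed.

Lemma combination_rank b : b != 0 -> (d <= \rank (combination b))%N.
Proof.
move=> b0; apply: Ms_rank.
  by apply: memv_suml => j _; rewrite memvZ // memv_span // mem_nth.
apply: contraNneq b0 => comb0; apply/eqP/rowP => j; rewrite mxE.
have := Ms_free; rewrite -[Ms]/(val (in_tuple Ms)) => /freeP.
by move=> /(_ (fun j => b 0 j)) ->.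
Qed.

(** For [b = 0] the vector is the nonzero constant [a]. Otherwise [r] solves a linear system of rank
    at least [d], with coordinates in a set of size [m]. *)
Lemma card_bad_r (a : 'rV['F_p]_m) (b : 'rV['F_p]_k) : (a != 0) || (b != 0) ->
  (#|[pred r : {ffun 'I_m -> 'I_m} | (a + (combination b *m natcol p r)^T == 0)%R]| * m ^ d
    <= m ^ m)%N.
Proof.
move=> ab0; case: (eqVneq b 0) ab0 => [b0|b0 _].
  rewrite orbF => a0; rewrite eq_card0 // => r; rewrite inE /combination b0.
  rewrite big1 => [|j _]; last by rewrite mxE scale0r.
  by rewrite mul0mx trmx0 addr0 (negbTE a0).
apply: leq_trans (card_solutions p_pr (combination b) (- a)^T m_le).
apply: leq_mul.
  apply/subset_leq_card/subsetP => r; rewrite !inE addrC addr_eq0 => /eqP <-.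
  by rewrite trmxK.
by rewrite leq_pexp2l // combination_rank.
Qed.

(** Stated without denominators: the fraction of roots is at most [1/p + m^-d]. For given [r] the
    form is affine in [s], and its linear part vanishes only for bad [r]. *)
Lemma roots_false (c : 'rV['F_p]_1) (a : 'rV['F_p]_m) (b : 'rV['F_p]_k) :
    (a != 0) || (b != 0) ->
  (#|[pred o | ev (point false o) (row_mx c (row_mx a b)) == 0%R]| * (p * m ^ d)
    <= #|secrets| * (m ^ d + p))%N.
Proof.
move=> ab0; rewrite card_triple1 /=.
pose bad (r : {ffun 'I_m -> 'I_m}) : bool :=
  a + (combination b *m natcol p r)^T == 0.
(* After multiplication by [p], a good [r] contributes at most [p^m] and a bad one, where every [s]
   may be a root, at most [p^m * p]. *)
apply: (@leq_trans (\sum_(r : {ffun 'I_m -> 'I_m}) \sum_(eta : {ffun 'I_k -> 'I_p})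
  (p ^ m + bad r * (p ^ m * p)) * m ^ d)%N).
  rewrite big_distrl /=; apply: leq_sum => r _; rewrite big_distrl /=.
  apply: leq_sum => eta _; rewrite mulnA leq_mul2r; apply/orP; right.
  have [bad_r|good_r] := boolP (bad r).
    apply: leq_trans (leq_addl _ _); rewrite mul1n leq_mul2r; apply/orP; right.
    by apply: leq_trans (max_card _) _; rewrite card_ffun !card_ord.
  rewrite mul0n addn0.
  apply: leq_trans (card_hyperplane p_pr (- c 0 0) good_r).
  rewrite leq_mul2r; apply/orP; right.
  apply/subset_leq_card/subsetP => s; rewrite !inE ev_point_real /=.
  by rewrite addrC addr_eq0.
under eq_bigr do rewrite sum_nat_const card_ffun !card_ord.
rewrite -big_distrr -big_distrl /= big_split /= sum_nat_const card_ffun !card_ord.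
rewrite -big_distrl /= card_secrets.
have -> : (\sum_r bad r = #|[pred r | bad r]|)%N.
  by rewrite -sum1_card [RHS]big_mkcond; apply: eq_bigr => r _; rewrite inE; case: (bad r).
have := card_bad_r ab0; rewrite -/bad; set B := #|_| => leB.
have := leq_mul leB (leqnn (p ^ m * p * p ^ k)%N); nia.
Qed.

(** If [b] is nonzero, [eta] lies on a hyperplane for fixed [s] and [r]; if [b = 0], then [s]
    does. *)
Lemma roots_true (c : 'rV['F_p]_1) (a : 'rV['F_p]_m) (b : 'rV['F_p]_k) :
    (a != 0) || (b != 0) ->
  (#|[pred o | ev (point true o) (row_mx c (row_mx a b)) == 0%R]| * p <= #|secrets|)%N.
Proof.
have [b0|b0 _] := eqVneq b 0.
  rewrite orbF => a0; rewrite card_triple1 card_secrets big_distrl /=.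
  apply: (@leq_trans (\sum_(r : {ffun 'I_m -> 'I_m}) \sum_(eta : {ffun 'I_k -> 'I_p})
      p ^ m)%N).
    apply: leq_sum => r _; rewrite big_distrl /=; apply: leq_sum => eta _.
    apply: leq_trans (card_hyperplane p_pr (- c 0 0) a0).
    rewrite leq_mul2r; apply/orP; right; apply/subset_leq_card/subsetP => s.
    by rewrite !inE ev_point b0 mul0mx [X in _ + (_ + X)]mxE addr0 addrC addr_eq0.
  by rewrite !sum_nat_const !card_ffun !card_ord; lia.
rewrite card_triple3 card_secrets big_distrl /=.
apply: (@leq_trans (\sum_(s : {ffun 'I_m -> 'I_p}) \sum_(r : {ffun 'I_m -> 'I_m})
    p ^ k)%N).
  apply: leq_sum => s _; rewrite big_distrl /=; apply: leq_sum => r _.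
  apply: leq_trans (card_hyperplane p_pr (- (c 0 0 + (a *m natcol p s) 0 0)) b0).
  rewrite leq_mul2r; apply/orP; right; apply/subset_leq_card/subsetP => eta.
  rewrite !inE ev_point addrA addrC addr_eq0 /=.
  by congr (_ == _); rewrite !mxE; apply: eq_bigr => j _; rewrite !mxE.
by rewrite !sum_nat_const !card_ffun !card_ord; lia.
Qed.

Lemma root_prob_point (R : realFieldType) beta (f : 'rV['F_p]_(1 + (m + k))) :
    f != 0 ->
  #|[pred o | ev (point beta o) f == 0]|%:R
    <= (m%:R ^- d + p%:R^-1) * #|secrets|%:R :> R.
Proof.
rewrite -[f]hsubmxK -[rsubmx f]hsubmxK.
move: (lsubmx f) (lsubmx (rsubmx f)) (rsubmx (rsubmx f)) => c a b f0.
have p0 : 0 < p%:R :> R by rewrite ltr0n prime_gt0.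
have m0 : 0 < m%:R ^+ d :> R by rewrite exprn_gt0 // ltr0n.
have [|] := boolP ((a != 0) || (b != 0)); last first.
  (* Only the coordinate of the generator is left: a nonzero constant, without roots. *)
  rewrite negb_or !negbK => /andP[/eqP a0 /eqP b0].
  have c0 : c 0 0 != 0.
    apply: contraNneq f0 => c0; rewrite a0 b0 row_mx0.
    by rewrite [c]mx11_scalar c0 raddf0 row_mx0.
  rewrite eq_card0 => [|o]; first by rewrite mulr_ge0 // addr_ge0 // ltW // invr_gt0.
  by rewrite !inE ev_point a0 b0 !mul0mx !mxE !addr0 (negbTE c0).
case: beta => ab0.
  apply: (@le_trans _ _ (p%:R^-1 * #|secrets|%:R)).
    by rewrite ler_pdivlMl // -natrM ler_nat mulnC roots_true.
  by rewrite ler_wpM2r // lerDr ltW // invr_gt0.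
have := roots_false c ab0; rewrite -(ler_nat R) !natrM natrD natrX.
set B := #|_|%:R; set S := #|_|%:R => le_BS.
have -> : (m%:R ^- d + p%:R^-1) * S = S * (m%:R ^+ d + p%:R) / (p%:R * m%:R ^+ d).
  by field; rewrite !gt_eqF.
by rewrite ler_pdivlMr // mulr_gt0.
Qed.

End Secrets.

(** * Rejection sampling *)

Lemma ohead_mem (T : eqType) (s : seq T) (a : T) : ohead s = Some a -> a \in s.
Proof. by case: s => //= b s [->]; rewrite mem_head. Qed.

Section Sampling.

Variables tries n bound : nat.
Implicit Types (t : attempts tries n bound) (v : {ffun 'I_n -> 'I_bound}).

Definition yields t v : bool := [forall i, sampled t i == Some (v i : nat)].

Lemma yieldsP t v : reflect (forall i, sampled t i = Some (v i : nat)) (yields t v).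
Proof. by apply: (iffP forallP) => tv i; apply/eqP/tv. Qed.

Lemma sampled_lt t i a : sampled t i = Some a -> (a < bound)%N.
Proof.
by move=> /ohead_mem; rewrite mem_filter => /andP[].
Qed.

Lemma sampling_okP t : sampling_ok t = [exists v, yields t v].
Proof.
apply/forallP/existsP => [ok|[v /yieldsP tv] i]; last by rewrite tv.
have lt i : (sample t i < bound)%N.
  by rewrite /sample; have := ok i; case E: sampled => [a|//] _; apply: sampled_lt E.
exists [ffun i => Ordinal (lt i)]; apply/yieldsP => i; rewrite ffunE /sample /=.
by have := ok i; case: sampled.
Qed.

Lemma yields_inj t v v' : yields t v -> yields t v' -> v = v'.
Proof.
move=> /yieldsP tv /yieldsP tv'; apply/ffunP => i; apply: val_inj.
by have := tv i; rewrite tv' => -[].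
Qed.

Lemma ohead_relabel (T : Type) (B : nat) (pi : {perm 'I_B}) (g : T -> 'I_B)
    (s : seq T) (a b : 'I_B) :
    (forall i, (pi i < bound)%N = (i < bound)%N) -> pi a = b ->
  ohead [seq x <- [seq nat_of_ord (g l) | l <- s] | (x < bound)%N] = Some (a : nat) ->
  ohead [seq x <- [seq nat_of_ord (pi (g l)) | l <- s] | (x < bound)%N] = Some (b : nat).
Proof.
move=> pi_bound pi_ab; elim: s => //= l s IH; rewrite pi_bound.
by case: ifP => //= _ [/val_inj ->]; rewrite pi_ab.
Qed.

Lemma bound_le : (bound <= 2 ^ up_log 2 bound)%N.
Proof. exact: up_logP. Qed.

(** Swapping the values [v i] and [v' i] in all attempts for coordinate [i] keeps which attempts are
    accepted, so all samples are equally likely. *)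
Lemma card_yields_le v v' :
  (#|[pred t | yields t v]| <= #|[pred t | yields t v']|)%N.
Proof.
pose wide := widen_ord bound_le.
pose swap t : attempts tries n bound :=
  [ffun i => [ffun l => tperm (wide (v i)) (wide (v' i)) (t i l)]].
have swapK : involutive swap.
  by move=> t; apply/ffunP => i; apply/ffunP => l; rewrite !ffunE tpermK.
rewrite -(card_imset [pred t | yields t v] (inv_inj swapK)).
apply/subset_leq_card/subsetP => _ /imsetP[t + ->]; rewrite !inE => /yieldsP tv.
apply/yieldsP => i; have := tv i; rewrite /sampled.
under [X in _ -> ohead (seq.filter _ X) = _]eq_map do rewrite !ffunE.
apply: (@ohead_relabel _ _ (tperm (wide (v i)) (wide (v' i))) _ _ (wide (v i)) (wide (v' i))).
  by move=> j; case: tpermP => [->|->|//]; rewrite /= !ltn_ord.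
by rewrite tpermL.
Qed.

(** The constant is the number of coins behind each sample. It is chosen before [G] and [F], so one
    constant serves both messages and the normalisation. *)
Lemma sum_sampling (R : comNzRingType) : exists c : nat,
  forall (G : attempts tries n bound -> R) (F : {ffun 'I_n -> 'I_bound} -> R),
    (forall t v, yields t v -> G t = F v) ->
  \sum_(t | sampling_ok t) G t = c%:R * \sum_v F v.
Proof.
have [c cE] : exists c, forall v, #|[pred t | yields t v]| = c.
  case: (pickP [pred v : {ffun 'I_n -> 'I_bound} | true]) => [v _|no_v].
    exists #|[pred t | yields t v]| => v'.
    by apply/eqP; rewrite eqn_leq !card_yields_le.
  by exists 0%N => v; have := no_v v.
exists c => G F GF.
transitivity (\sum_(t | sampling_ok t) \sum_(v | yields t v) F v).
  apply: eq_bigr => t; rewrite sampling_okP => /existsP[v tv].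
  rewrite (GF t v tv) (bigD1 v) //= big1 ?addr0 // => v' /andP[tv'].
  by rewrite (yields_inj tv tv') eqxx.
rewrite (exchange_big_dep predT) //= mulr_sumr; apply: eq_bigr => v _.
rewrite -(cE v) mulrC mulr_natr -sumr_const; apply: eq_bigl => t.
rewrite !inE sampling_okP andb_idl // => tv; by apply/existsP; exists v.
Qed.

End Sampling.

Section Coins.

Variables (m p : nat) (Ms : seq 'M['F_p]_m).
Local Notation k := (size Ms).

Definition coins_ok (c : enc_coins m k p) : bool :=
  let: (sigma, ts, tr, te) := c in
  [&& sampling_ok ts, sampling_ok tr & sampling_ok te].

Lemma sum_enc_coins (R : comNzRingType) : exists c : nat,
  forall (G : enc_coins m k p -> R) (F : secrets Ms -> encoding p -> R),
    (forall sigma ts tr te s r eta, yields ts s -> yields tr r -> yields te eta ->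
      G (sigma, ts, tr, te) = F (s, r, eta) sigma) ->
  \sum_(cc | coins_ok cc) G cc = c%:R * \sum_o \sum_sigma F o sigma.
Proof.
have [c1 c1E] := sum_sampling m m p R.
have [c2 c2E] := sum_sampling m m m R.
have [c3 c3E] := sum_sampling m k p R.
exists (c1 * (c2 * c3))%N => G F GF; rewrite !natrM.
pose T1 := attempts m m p; pose T2 := attempts m m m; pose T3 := attempts m k p.
transitivity (\sum_(sigma : encoding p) \sum_(ts : T1 | sampling_ok ts)
  \sum_(tr : T2 | sampling_ok tr) \sum_(te : T3 | sampling_ok te) G (sigma, ts, tr, te)).
  under [RHS]eq_bigr do under eq_bigr do rewrite pair_big /=.
  under [RHS]eq_bigr do rewrite pair_big /=.
  rewrite [RHS]pair_big /=.
  rewrite (reindex (fun q : encoding p * (T1 * (T2 * T3)) => (q.1, q.2.1, q.2.2.1, q.2.2.2))) /=.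
    by apply: eq_big => [[sigma [ts [tr te]]]|[sigma [ts [tr te]]] _].
  exists (fun q : enc_coins m k p => (q.1.1.1, (q.1.1.2, (q.1.2, q.2)))).
    by move=> [sigma [ts [tr te]]].
  by move=> [[[sigma ts] tr] te].
transitivity (\sum_(sigma : encoding p) c1%:R *
  \sum_s c2%:R * \sum_r c3%:R * \sum_eta F (s, r, eta) sigma).
  apply: eq_bigr => sigma _; apply: c1E => ts s ts_s; apply: c2E => tr r tr_r.
  by apply: c3E => te eta te_eta; apply: GF.
under eq_bigr do (under eq_bigr do (rewrite -mulr_sumr mulrA); rewrite -mulr_sumr mulrA).
rewrite -mulr_sumr; congr (_ * _); rewrite [RHS]exchange_big /=.
apply: eq_bigr => sigma _; rewrite pair_bigA pair_bigA /=.
by apply: eq_bigr => -[[s r] eta].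
Qed.

End Coins.

(** * Random coins of the adversary and the distinguishing gap *)

Section Mixture.

Local Open Scope classical_set_scope.

Variables (R : realType) (disp : measure_display) (W : measurableType disp).
Variable (P : probability W R).

Lemma fine_measureDI (D S : set W) : measurable D -> measurable S ->
  fine (P D) = fine (P (D `\` S)) + fine (P (D `&` S)).
Proof.
move=> mD mS; rewrite (measureDI P mD mS) fineD //; apply: fin_num_measure.
  exact: measurableD.
exact: measurableI.
Qed.

(** A pointwise bound on a combination of indicators passes to measures without integrals: [D] is
    cut by one event after another, until the combination is constant on each piece. *)
Lemma mixture_le_in (I : Type) (c : I -> R) (f : I -> W -> bool) (s : seq I)
    (D : set W) (b : R) :
    (forall i, measurable [set w | f i w]) -> measurable D ->
    (forall w, D w -> \sum_(i <- s) c i * (f i w)%:R <= b) ->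
  \sum_(i <- s) c i * fine (P (D `&` [set w | f i w])) <= b * fine (P D).
Proof.
move=> mf; elim: s D b => [|i s IH] D b mD le_b.
  (* On an empty [D] nothing is known about the sign of [b], but both sides vanish. *)
  rewrite big_nil; have [->|/set0P[w Dw]] := eqVneq D set0.
    by rewrite measure0 mulr0.
  by have := le_b w Dw; rewrite big_nil => b0; rewrite mulr_ge0 // fine_ge0.
rewrite big_cons; set S := [set w | f i w].
have mS : measurable S by apply: mf.
have in_le : \sum_(j <- s) c j * fine (P ((D `&` S) `&` [set w | f j w]))
    <= (b - c i) * fine (P (D `&` S)).
  (* Inside the event of [i] its coefficient moves to the bound. *)
  apply: IH; first exact: measurableI.
  move=> w [Dw Sw]; have := le_b w Dw; rewrite big_cons.
  have -> : f i w by [].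
  by rewrite mulr1 lerBrDl.
have out_le : \sum_(j <- s) c j * fine (P ((D `\` S) `&` [set w | f j w]))
    <= b * fine (P (D `\` S)).
  apply: IH; first exact: measurableD.
  move=> w [Dw Sw]; have := le_b w Dw; rewrite big_cons.
  have /negbTE -> : ~~ f i w by apply/negP.
  by rewrite mulr0 add0r.
have -> : \sum_(j <- s) c j * fine (P (D `&` [set w | f j w])) =
    \sum_(j <- s) c j * fine (P ((D `\` S) `&` [set w | f j w])) +
    \sum_(j <- s) c j * fine (P ((D `&` S) `&` [set w | f j w])).
  rewrite -big_split /=; apply: eq_bigr => j _; rewrite -mulrDr; congr (_ * _).
  rewrite (@fine_measureDI (D `&` [set w | f j w]) S) //; last exact: measurableI.
  by rewrite setIAC !setDE setIAC.
rewrite (fine_measureDI mD mS); lra.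
Qed.

Lemma mixture_norm_le (I : finType) (c : I -> R) (f : I -> W -> bool) (b : R) :
    (forall i, measurable [set w | f i w]) ->
    (forall w, `|\sum_i c i * (f i w)%:R| <= b) ->
  `|\sum_i c i * fine (P [set w | f i w])| <= b.
Proof.
move=> mf le_b; have PT : fine (P setT) = 1 by rewrite probability_setT.
have bound (e : R) : e = 1 \/ e = -1 -> e * (\sum_i c i * fine (P [set w | f i w])) <= b.
  move=> e1; rewrite mulr_sumr -[leRHS]mulr1 -PT.
  under eq_bigr do rewrite -[X in P X]setTI mulrA.
  apply: mixture_le_in => // w _; apply: le_trans (le_b w).
  under eq_bigr do rewrite -mulrA.
  rewrite -mulr_sumr; case: e1 => ->; rewrite ?mul1r ?mulN1r ?ler_norm //.
  by rewrite -normrN ler_norm.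
by rewrite ler_norml lerNl -mulN1r -[X in _ && (X <= _)]mul1r !bound //; [left|right].
Qed.

End Mixture.

(** * Ciphertexts as lists of handles *)

Section EncryptionPoint.

Variables (m p : nat) (Ms : seq 'M['F_p]_m).
Local Notation k := (size Ms).

(** The coordinate forms of [point], in the order in which the ciphertext lists the group
    elements. *)
Definition handles : seq 'rV['F_p]_(1 + (m + k)) :=
  delta_mx 0 (lshift (m + k) ord0) ::
  [seq delta_mx 0 (rshift 1 (lshift k i)) | i : 'I_m] ++
  [seq delta_mx 0 (rshift 1 (rshift m j)) | j : 'I_k].

Lemma size_handles : size handles = (1 + m + k)%N.
Proof. by rewrite /= size_cat !size_image !card_ord. Qed.

Definition read_ciphertext (ans : seq bitstring) : ciphertext :=
  Ciphertext p (head [::] ans) (take m (behead ans)) (drop m (behead ans)).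

Lemma ev_delta n (v : 'cV['F_p]_n) i : ev v (delta_mx 0 i) = v i 0.
Proof. by rewrite /ev -rowE mxE. Qed.

Lemma encrypt_point beta sigma ts tr te s r eta :
    yields ts s -> yields tr r -> yields te eta ->
  @encrypt m p Ms beta (sigma, ts, tr, te) =
  Encryption
    (read_ciphertext [seq encode sigma (ev (@point p m Ms beta (s, r, eta)) g) | g <- handles])
    (group_oracle sigma).
Proof.
move=> ts_s tr_r te_eta; rewrite /encrypt.
have ok tries n b (t : attempts tries n b) v : yields t v -> sampling_ok t.
  by move=> tv; rewrite sampling_okP; apply/existsP; exists v.
rewrite (ok _ _ _ _ _ ts_s) (ok _ _ _ _ _ tr_r) (ok _ _ _ _ _ te_eta) /=.
have natcolE n b (t : attempts m n b) v : yields t v ->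
    \col_i (sample t i)%:R = natcol p v.
  by move=> /yieldsP tv; apply/matrixP => i j; rewrite !mxE /sample tv.
rewrite (natcolE _ _ _ _ ts_s) (natcolE _ _ _ _ tr_r) /read_ciphertext /=.
have szX : size [seq encode sigma (ev (@point p m Ms beta (s, r, eta)) g) |
    g <- [seq delta_mx 0 (rshift 1 (lshift k i)) | i : 'I_m]] = m.
  by rewrite size_map size_image card_ord.
rewrite map_cat take_size_cat // drop_size_cat // /image_mem -!map_comp.
congr (Encryption (Ciphertext p (encode sigma _) _ _) _).
- by rewrite ev_delta col_mxEu mxE.
- by apply: eq_map => i /=; rewrite ev_delta col_mxEd col_mxEu.
- apply: eq_map => j /=; rewrite ev_delta !col_mxEd [exponents _ _ _ _]mxE /=.
  by have /yieldsP te_j := te_eta; rewrite /sample te_j.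
Qed.

End EncryptionPoint.

(** The error is [2 T^2 eps + 2 T / p]; with [1/p <= eps] and [T <= 2 Q] this is at most
    [4 T^2 eps <= 16 Q^2 eps]. *)
Lemma error_diag (R : realFieldType) (p T Q : nat) (eps : R) :
    (0 < p)%N -> (0 < T)%N -> (T <= Q.*2)%N -> p%:R^-1 <= eps ->
  error p eps T T <= 16 * (Q%:R ^+ 2 * eps).
Proof.
move=> p0 T0 TQ eps_ge; rewrite /error.
have T1 : 1 <= T%:R :> R by rewrite ler1n.
have TQ' : T%:R <= 2 * Q%:R :> R by rewrite -natrM ler_nat mul2n.
have inv0 : 0 < p%:R^-1 :> R by rewrite invr_gt0 ltr0n.
have sq : T%:R ^+ 2 <= 4 * Q%:R ^+ 2 :> R.
  have -> : 4 * Q%:R ^+ 2 = (2 * Q%:R) ^+ 2 :> R by ring.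
  by rewrite lerXn2r ?nnegrE.
have lin : T%:R * p%:R^-1 <= T%:R ^+ 2 * eps.
  rewrite expr2 -mulrA ler_wpM2l // -[leLHS]mul1r ler_pM // ltW.
have : T%:R ^+ 2 * eps <= 4 * Q%:R ^+ 2 * eps by rewrite ler_wpM2r // (le_trans _ eps_ge) // ltW.
lra.
Qed.

(** * Distinguishing gap for fixed adversary coins *)

Section Gap.

Variables (R : realType) (m d p Q : nat) (Ms : seq 'M['F_p]_m).
Hypothesis p_pr : prime p.
Hypothesis m_gt0 : (0 < m)%N.
Hypothesis m_le : (m <= p)%N.
Hypothesis Ms_free : free Ms.
Hypothesis Ms_rank : forall M, M \in <<Ms>>%VS -> M != 0 -> (d <= \rank M)%N.

Local Notation k := (size Ms).

Definition gap_bound : R :=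
  16 * ((Q + m + k)%:R ^+ 2 * (m%:R ^- d + p%:R^-1)).

Lemma eps_ge0 : 0 <= m%:R ^- d + p%:R^-1 :> R.
Proof. by rewrite addr_ge0 // invr_ge0 ?exprn_ge0. Qed.

Lemma gap_bound_ge0 : 0 <= gap_bound.
Proof. by rewrite /gap_bound mulr_ge0 ?mulr_ge0 ?exprn_ge0 ?eps_ge0. Qed.

Lemma encrypt_gap (W : Type) (A : adversary W) (lam : nat) (phi : circuit) (w : W) :
    (forall beta c, adv_queries A lam phi w (@encrypt m p Ms beta c) <= Q)%N ->
  `|\sum_(c | coins_ok c) ((adv_output A lam phi w (@encrypt m p Ms false c))%:R
      - (adv_output A lam phi w (@encrypt m p Ms true c))%:R)|
    <= gap_bound * #|[pred c : enc_coins m k p | coins_ok c]|%:R :> R.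
Proof.
move=> AQ; have p_gt0 := prime_gt0 p_pr.
have p0 : 0 < p%:R :> R by rewrite ltr0n.
have dge0 : 0 <= m%:R ^- d :> R by rewrite invr_ge0 exprn_ge0.
(* If there are more steps than field elements, then [p <= Q + m + k] and the claimed bound is at
   least 1. *)
have [small|large] := leqP (1 + m + k + Q) p; last first.
  apply: (@le_trans _ _ #|[pred c : enc_coins m k p | coins_ok c]|%:R).
    apply: le_trans (ler_norm_sum _ _ _) _.
    rewrite -sum1_card natr_sum; apply: ler_sum => c _.
    by do 2 case: (adv_output _ _ _ _ _); rewrite ?subrr ?subr0 ?sub0r ?normrN ?normr1 ?normr0.
  rewrite ler_peMl //.
  have -> : 1 = p%:R * p%:R^-1 :> R by rewrite divff // gt_eqF.
  apply: (@le_trans _ _ ((Q + m + k)%:R ^+ 2 * p%:R^-1)).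
    rewrite ler_wpM2r ?invr_ge0 // -natrX ler_nat; nia.
  rewrite /gap_bound -[leLHS]mul1r ler_pM // ?ler1n //.
  by rewrite ler_wpM2l ?exprn_ge0 // lerDr.
(* The number of coins behind each secret appears on both sides and cancels. *)
have [c0 c0E] := sum_enc_coins Ms R.
pose K ans := A w lam phi (Some (read_ciphertext m p ans)).
pose accept beta (o : secrets Ms) sigma : R := (run_upto Q
  (K [seq encode sigma (ev (point beta o) g) | g <- handles Ms]) (group_oracle sigma))%:R.
have sumE beta : \sum_(c | coins_ok c) (adv_output A lam phi w (@encrypt m p Ms beta c))%:R
    = c0%:R * \sum_o \sum_sigma accept beta o sigma.
  apply: c0E => sigma ts tr te s r eta ts_s tr_r te_eta.
  have := AQ beta (sigma, ts, tr, te).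
  by rewrite (encrypt_point _ _ ts_s tr_r te_eta) /= => /run_uptoE; rewrite /accept /K => ->.
have -> : #|[pred c : enc_coins m k p | coins_ok c]|%:R
    = c0%:R * (#|secrets Ms| * #|encoding p|)%:R :> R.
  rewrite -sum1_card natr_sum (c0E _ (fun _ _ => 1)) //.
  by rewrite !sumr_const -mulrnA mulnC.
rewrite sumrB !sumE -mulrBr normrM normr_nat mulrCA; apply: ler_wpM2l => //.
have small' : (size (handles Ms) + Q <= p)%N by rewrite size_handles.
apply: le_trans (generic_advantage p_pr eps_ge0
  (root_prob_point p_pr m_gt0 m_le Ms_free Ms_rank R) K small') _.
apply: ler_wpM2r => //; rewrite size_handles /gap_bound; apply: error_diag => //.
  (* The extra handle is the generator; [m > 0] gives [1 + m + k + Q <= 2 (Q + m + k)]. *)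
  by lia.
by rewrite lerDr.
Qed.

End Gap.

Lemma found_prime_range (m : nat) (t : prime_coins m) (p : nat) :
  found_prime t = Some p -> prime p /\ (2 ^ m <= p < 2 ^ m.+1)%N.
Proof.
move=> /ohead_mem; rewrite mem_filter => /andP[p_pr /mapP[l _ pE]]; split=> //.
by rewrite pE leq_addr [(2 ^ m.+1)%N]expnS mul2n -[X in (_ < X)%N]addnn ltn_add2l ltn_ord.
Qed.

(** These put every prime from [2 ^ m] on above the threshold of the reduction. *)
Lemma mat_dim_bounds (N : nat) :
  (N < mat_dim N)%N /\ (2 * N * log_floor N < mat_dim N)%N.
Proof.
rewrite /mat_dim; set b := 'C(_, _); have : (0 < b)%N by rewrite bin_gt0 leq_pmull.
move: b (2 * N * log_floor N)%N => b x b0; nia.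
Qed.

(** The common factor [a] is the weight of the accepted prime. If the conditioning event is
    impossible, both quotients are 0 by the convention on division. *)
Lemma ratio_gap (R : realFieldType) (a s0 s1 D b : R) : 0 <= D -> 0 <= b ->
  `|s0 - s1| <= b * D -> `|a * s0 / (a * D) - a * s1 / (a * D)| <= b.
Proof.
move=> D0 b0 le_b; have [->|aN] := eqVneq a 0; first by rewrite !mul0r subrr normr0.
have [DE|DN] := eqVneq D 0; first by rewrite DE mulr0 invr0 !mulr0 subrr normr0.
have -> : a * s0 / (a * D) - a * s1 / (a * D) = (s0 - s1) / D.
  by field; rewrite aN DN.
by rewrite normrM normfV (ger0_norm D0) ler_pdivrMr // lt0r DN.
Qed.

(** * Conditional and averaged advantage *)

Section Advantage.

Variables (R : realType) (csize : circuit -> nat) (red : reduction).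
Variables (lam : nat) (phi : circuit).
Variables (disp : measure_display) (W : measurableType disp).
Variables (P : probability W R) (A : adversary W) (Q : nat).
Hypothesis red_spec : matrix_reduction csize red.
Hypothesis phi_unsat : ~ satisfiable phi.
Hypothesis A_measurable : measurable_adversary lam phi A.
Hypothesis A_queries : makes_queries red csize lam phi A Q.

Local Notation N := (param_N csize lam phi).
Local Notation m := (mat_dim N).
Local Notation d := (param_d N).
Local Notation Ms := (red phi N).
Local Notation k p := (size (Ms p)).
Local Notation accept := (accept_prob lam phi P A).

Lemma reduction_spec_at (p : nat) : prime p -> (2 ^ m <= p < 2 ^ m.+1)%N ->
  reduction_spec csize red phi N p.
Proof.
move=> p_pr /andP[le_p _]; have [Nm rm] := mat_dim_bounds N.
apply: red_spec => //.
- by rewrite /param_N; lia.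
- by rewrite /param_N leq_maxr.
rewrite gtn_max; apply/andP; split; apply: leq_trans le_p.
  by rewrite ltn_exp2l.
by apply: ltn_trans rm _; rewrite ltn_expl.
Qed.

Lemma accept_gap (p : nat) : prime p -> (2 ^ m <= p < 2 ^ m.+1)%N ->
  `|\sum_(c : enc_coins m (k p) p | coins_ok c)
      (accept (encrypt false c) - accept (encrypt true c))|
    <= gap_bound R d Q (Ms p) *
         #|[pred c : enc_coins m (k p) p | coins_ok c]|%:R.
Proof.
move=> p_pr p_range; have [Ms_free _ Ms_rank] := reduction_spec_at p_pr p_range.
have [Nm _] := mat_dim_bounds N.
have m_gt0 : (0 < m)%N by apply: leq_ltn_trans Nm.
have m_le : (m <= p)%N.
  by have /andP[le_p _] := p_range; apply: leq_trans le_p; apply/ltnW/ltn_expl.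
have Ms_rank' M : M \in <<Ms p>>%VS -> M != 0 -> (d <= \rank M)%N.
  by rewrite /param_d addnC; apply: Ms_rank.
(* Signs for the two messages, and 0 for aborting coins, turn the difference into a single mixture
   over pairs of a message and coins. *)
pose coef (i : bool * enc_coins m (k p) p) : R :=
  if coins_ok i.2 then (if i.1 then -1 else 1) else 0.
have coefE (F : bool -> enc_coins m (k p) p -> R) :
    \sum_(c | coins_ok c) (F false c - F true c) = \sum_i coef i * F i.1 i.2.
  rewrite -(pair_bigA _ (fun b c => coef (b, c) * F b c)) big_bool /= -big_split /=.
  rewrite big_mkcond; apply: eq_bigr => c _; rewrite /coef /=.
  by case: (coins_ok c); rewrite ?mul0r ?addr0 // mulN1r mul1r addrC.
rewrite (coefE (fun b c => accept (encrypt b c))).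
apply: (@mixture_norm_le R disp W P _ coef
  (fun i w => adv_output A lam phi w (encrypt i.1 i.2))).
  by move=> i; apply: A_measurable.
move=> w; rewrite -(coefE (fun b c => (adv_output A lam phi w (encrypt b c))%:R)).
by apply: encrypt_gap => // b c; apply: A_queries.
Qed.

(** Isolates the factor that depends on the prime search alone; it is common to both messages and
    cancels in the conditional probabilities. *)
Lemma expect_success (p : nat) (beta : bool) (f : outcome -> R) :
  expect red csize lam phi beta (fun o => (success_with p o)%:R * f o) =
  mean (fun t : prime_coins m => (found_prime t == Some p)%:R)
    / #|enc_coins m (k p) p|%:R *
  \sum_(c : enc_coins m (k p) p | coins_ok c) f (encrypt beta c).
Proof.
have okE p' (c : enc_coins m (k p') p') :
    success_with p (encrypt beta c) = coins_ok c && (p' == p).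
  by case: c => [[[sigma ts] tr] te]; rewrite /encrypt /coins_ok; case: ifP.
rewrite /expect {1}/mean mulrAC -mulrA [RHS]mulrC mulrA; congr (_ / _).
rewrite mulrC mulr_suml; apply: eq_bigr => t _.
case: (found_prime t) => [p'|]; last by rewrite !mul0r.
have [->|neq_p] := eqVneq p' p.
  rewrite eqxx mul1r /mean mulrC [RHS]mulrC; congr (_ * _).
  rewrite [RHS]big_mkcond; apply: eq_bigr => c _; rewrite okE eqxx andbT.
  by case: (coins_ok c); rewrite ?mul1r ?mul0r.
have -> : (Some p' == Some p) = false by apply/negbTE; apply: contraNneq neq_p => -[->].
rewrite mul0r /mean big1 ?mul0r // => c _.
by rewrite okE (negbTE neq_p) andbF mul0r.
Qed.

Lemma advantage_given_le (p : nat) : prime p -> (2 ^ m <= p < 2 ^ m.+1)%N ->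
  advantage_given red csize lam phi P A p <= gap_bound R d Q (Ms p).
Proof.
move=> p_pr p_range; rewrite /advantage_given /prob_one_given.
have denE beta : expect red csize lam phi beta (fun o => (success_with p o)%:R) =
    mean (fun t : prime_coins m => (found_prime t == Some p)%:R)
      / #|enc_coins m (k p) p|%:R *
    #|[pred c : enc_coins m (k p) p | coins_ok c]|%:R :> R.
  rewrite -[X in _ = _ * X%:R]sum1_card natr_sum -[RHS](expect_success p beta (fun _ => 1)).
  rewrite /expect /mean; congr (_ / _); apply: eq_bigr => t _.
  case: (found_prime t) => [p'|]; last by rewrite mulr1.
  by congr (_ / _); apply: eq_bigr => c _; rewrite mulr1.
rewrite !denE !(expect_success p _ accept); apply: ratio_gap => //.
  exact: gap_bound_ge0.
by rewrite -sumrB; apply: accept_gap.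
Qed.

Lemma advantage_le :
  advantage red csize lam phi P A <=
  expect_prime csize lam phi (fun p => gap_bound R d Q (Ms p)).
Proof.
rewrite /advantage /prob_one /expect /expect_prime {1 3}/mean -mulrBl -sumrB.
rewrite normrM normfV normr_nat ler_wpM2r ?invr_ge0 //.
apply: le_trans (ler_norm_sum _ _ _) _; apply: ler_sum => t _.
case E: (found_prime t) => [p|]; last by rewrite subrr normr0.
have [p_pr p_range] := found_prime_range E.
rewrite /mean -mulrBl -sumrB normrM normfV normr_nat.
have n_gt0 : (0 < #|enc_coins m (k p) p|)%N \/ #|enc_coins m (k p) p| = 0%N.
  by case: #|_| => [|n]; [right|left].
(* Coins on which sampling fails give [Abort] for both messages and cancel. *)
rewrite (bigID (@coins_ok m p (Ms p))) /= [X in _ + X]big1 ?addr0; last first.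
  move=> [[[sigma ts] tr] te]; rewrite /coins_ok /encrypt => /negbTE ->.
  by rewrite subrr.
apply: le_trans (ler_wpM2r _ (accept_gap p_pr p_range)) _; first by rewrite invr_ge0.
case: n_gt0 => [n_gt0|->]; last by rewrite invr0 mulr0 gap_bound_ge0.
rewrite -mulrA ler_piMr ?gap_bound_ge0 //.
by rewrite ler_pdivrMr ?ltr0n // mul1r ler_nat max_card.
Qed.

End Advantage.

Theorem theorem3p5 :
  exists c : nat,
  forall (R : realType) (csize : circuit -> nat) (red : reduction)
    (lam : nat) (phi : circuit)
    (disp : measure_display) (W : measurableType disp) (P : probability W R)
    (A : adversary W) (Q : nat),
    matrix_reduction csize red ->
    ~ satisfiable phi ->
    measurable_adversary lam phi A ->
    makes_queries red csize lam phi A Q ->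
    let N := param_N csize lam phi in
    let m := mat_dim N in
    let d := param_d N in
    let k p := size (red phi N p) in
    (forall p : nat, prime p -> (2 ^ m <= p < 2 ^ m.+1)%N ->
      advantage_given red csize lam phi P A p
        <= c%:R * ((Q + m + k p)%:R ^+ 2 * (m%:R ^- d + p%:R^-1)))
    /\
    advantage red csize lam phi P A
      <= expect_prime csize lam phi (fun p =>
           c%:R * ((Q + m + k p)%:R ^+ 2 * (m%:R ^- d + 2%:R ^- m))).
Proof.
exists 16%N => R csize red lam phi disp W P A Q red_spec unsat meas queries N m d k.
split=> [p p_pr p_range|]; first exact: advantage_given_le.
apply: le_trans (advantage_le P red_spec unsat meas queries) _.
rewrite /expect_prime /mean ler_wpM2r ?invr_ge0 //; apply: ler_sum => t _.
case E: (found_prime t) => [p|//]; have [_ /andP[le_p _]] := found_prime_range E.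
(* The prime found is at least [2 ^ m], so its inverse is at most [2 ^- m]. *)
rewrite /gap_bound !ler_wpM2l ?exprn_ge0 // lerD2l lef_pV2 ?posrE ?exprn_gt0 //.
  by rewrite -natrX ler_nat.
by rewrite ltr0n (leq_trans _ le_p) // expn_gt0.
Qed.
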